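(* There are no simple mixed $NS$-modules. That is, there is no simple weight $NS$-module $M$ for which there exist $\lambda\in\mathbb{C}$ and $k\in\frac{\mathbb{Z}}{2}$ such that $\dim M_\lambda=\infty$ and $\dim M_{\lambda+k}<\infty$.
   Context: The Neveu-Schwarz algebra $NS$ is the complex Lie superalgebra $NS=NS_{\bar 0}\oplus NS_{\bar 1}$, where $NS_{\bar 0}$ has basis $\{L_n, c\mid n\in\mathbb{Z}\}$ and $NS_{\bar 1}$ has basis $\{G_r\mid r\in\frac12+\mathbb{Z}\}$, with relations $[L_m,L_n]=(n-m)L_{m+n}-\delta_{m+n,0}\frac{m^3-m}{12}c$, $[L_m,G_r]=(r-\frac m2)G_{m+r}$, $[G_r,G_s]=2L_{r+s}+\frac{4r^2-1}{12}\delta_{r+s,0}c$, and $[NS,c]=0$, for $m,n\in\mathbb{Z}$, $r,s\in\frac12+\mathbb{Z}$. The bracket of two odd elements is the anticommutator $[G_r,G_s]=G_rG_s+G_sG_r$ in any module. The Cartan subalgebra is $\mathfrak h=\mathbb{C}L_0\oplus\mathbb{C}c$. A weight module is an $NS$-module on which $\mathfrak h$ acts diagonalizably. On a simple weight module $M$, $c$ acts by a scalar and $M=\bigoplus_{\mu\in\mathbb{C}} M_\mu$ with weight spaces $M_\mu=\{v\in M\mid L_0v=\mu v\}$ (possibly zero). A weight $NS$-module $M$ is called mixed if there exist $\lambda\in\mathbb{C}$ and $k\in\frac{\mathbb{Z}}{2}=\{n/2\mid n\in\mathbb{Z}\}$ such that $\dim M_\lambda=\infty$ and $\dim M_{\lambda+k}<\infty$.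 *)

(* Defs.v *)
From HB Require Import structures.
From mathcomp Require Import all_boot all_order all_algebra.
From mathcomp Require Import finmap reals complex monalg.

Set Implicit Arguments.
Unset Strict Implicit.
Unset Printing Implicit Defensive.

Import GRing.Theory.
Local Open Scope ring_scope.
Local Open Scope complex_scope.

(* The odd generator G_r, with r in 1/2 + Z, is encoded as [NSG i] with
   r = i + 1/2. *)
Inductive NSbasis := NSL of int | NSG of int | NSc.

Definition NSbasis_code (a : NSbasis) : int + int + unit :=
  match a with
  | NSL n => inl (inl n)
  | NSG i => inl (inr i)
  | NSc => inr tt
  end.

Definition NSbasis_decode (s : int + int + unit) : NSbasis :=
  match s with
  | inl (inl n) => NSL n
  | inl (inr i) => NSG i
  | inr _ => NSc
  end.

Lemma NSbasis_codeK : cancel NSbasis_code NSbasis_decode.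
Proof. by case. Qed.

HB.instance Definition _ := Choice.copy NSbasis (can_type NSbasis_codeK).

Section NeveuSchwarz.
Variable R : realType.

Definition NS := {malg R[i][NSbasis]}.

Definition NSe (a : NSbasis) : NS := mkmalgU a 1.

Definition half_shift (i : int) : R[i] := i%:~R + 2%:R^-1.

(* The index sum r + s of G_r and G_s, for r = i + 1/2 and s = j + 1/2, is the
   integer i + j + 1. *)
Definition NSbasis_bracket (a b : NSbasis) : NS :=
  match a, b with
  | NSL m, NSL n =>
      (n - m)%:~R *: NSe (NSL (m + n))
      - (if m + n == 0 then (m ^+ 3 - m)%:~R / 12%:R else 0) *: NSe NSc
  | NSL m, NSG i =>
      (half_shift i - m%:~R / 2%:R) *: NSe (NSG (m + i))
  | NSG i, NSL m =>
      - ((half_shift i - m%:~R / 2%:R) *: NSe (NSG (m + i)))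
  | NSG i, NSG j =>
      2%:R *: NSe (NSL (i + j + 1))
      + (if i + j + 1 == 0 then (4%:R * half_shift i ^+ 2 - 1) / 12%:R else 0)
          *: NSe NSc
  | NSc, _ => 0
  | _, NSc => 0
  end.

Definition NSbracket (x y : NS) : NS :=
  \sum_(a <- msupp x) \sum_(b <- msupp y)
    (mcoeff a x * mcoeff b y) *: NSbasis_bracket a b.

Definition NSbasis_odd (a : NSbasis) : bool :=
  if a is NSG _ then true else false.

(* [NShomog false] and [NShomog true] are the even and the odd part of NS. *)
Definition NShomog (p : bool) (x : NS) : Prop :=
  forall a, a \in msupp x -> NSbasis_odd a = p.

Record NSmodule := {
  NSsort :> lmodType R[i];
  NSact : NS -> NSsort -> NSsort;
  NSact_linear_l : forall v, linear (NSact^~ v);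
  NSact_linear_r : forall x, linear (NSact x);
  NSact_bracket : forall p q x y, NShomog p x -> NShomog q y ->
    forall v, NSact (NSbracket x y) v =
      NSact x (NSact y v) - (-1) ^+ (p && q) *: NSact y (NSact x v)
}.

Definition subspace (V : lmodType R[i]) (U : V -> Prop) : Prop :=
  U 0 /\ forall (a : R[i]) u v, U u -> U v -> U (a *: u + v).

Definition submodule (M : NSmodule) (U : M -> Prop) : Prop :=
  subspace U /\ forall x v, U v -> U (NSact x v).

Definition trivial_or_full (V : lmodType R[i]) (U : V -> Prop) : Prop :=
  (forall v, U v -> v = 0) \/ (forall v, U v).

Definition simple_module (M : NSmodule) : Prop :=
  (exists v : M, v <> 0) /\
  forall U : M -> Prop, submodule U -> trivial_or_full U.

Record NSgrading (M : NSmodule) := {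
  NSpart : bool -> M -> Prop;
  NSpart_subspace : forall p, subspace (NSpart p);
  NSpart_span : forall v, exists v0 v1,
    [/\ NSpart false v0, NSpart true v1 & v = v0 + v1];
  NSpart_direct : forall v, NSpart false v -> NSpart true v -> v = 0;
  NSpart_act : forall p q x v,
    NShomog p x -> NSpart q v -> NSpart (p (+) q) (NSact x v)
}.

Definition graded_submodule (M : NSmodule) (gr : NSgrading M) (U : M -> Prop)
    : Prop :=
  submodule U /\
  forall v0 v1, NSpart gr false v0 -> NSpart gr true v1 ->
    U (v0 + v1) -> U v0 /\ U v1.

Definition graded_simple_module (M : NSmodule) (gr : NSgrading M) : Prop :=
  (exists v : M, v <> 0) /\
  forall U : M -> Prop, graded_submodule gr U -> trivial_or_full U.

Definition in_cartan (h : NS) : Prop :=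
  exists a b : R[i], h = a *: NSe (NSL 0) + b *: NSe NSc.

Definition simultaneous_eigenvector (M : NSmodule) (w : M) : Prop :=
  w <> 0 /\ forall h, in_cartan h -> exists z : R[i], NSact h w = z *: w.

(* The Cartan subalgebra acts diagonalizably: its common eigenvectors span. *)
Definition weight_module (M : NSmodule) : Prop :=
  forall v : M, exists s : seq M,
    (forall w, w \in s -> simultaneous_eigenvector w) /\ v = \sum_(w <- s) w.

Definition weight_space (M : NSmodule) (mu : R[i]) (v : M) : Prop :=
  NSact (NSe (NSL 0)) v = mu *: v.

Definition finite_dim (V : lmodType R[i]) (U : V -> Prop) : Prop :=
  exists s : seq V,
    (forall u, u \in s -> U u) /\
    forall v, U v -> exists a : 'I_(size s) -> R[i],
      v = \sum_(i < size s) a i *: s`_i.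

Definition mixed (M : NSmodule) : Prop :=
  exists (lambda : R[i]) (k : int),
    ~ finite_dim (weight_space (M := M) lambda) /\
    finite_dim (weight_space (M := M) (lambda + k%:~R / 2%:R)).

End NeveuSchwarz.

(* Main.v *)
Require Import Defs.
From HB Require Import structures.
From mathcomp Require Import all_boot all_order all_algebra.
From mathcomp Require Import boolp reals complex ring zify finmap monalg.

(* Write x_n for the generator of degree n/2 (G_(n/2) for n odd, L_(n/2) for n
   even) and M_j for the weight space of weight mu + j/2.  An infinite
   dimensional weight space excludes vectors killed by x_1 and x_3 (or by x_(-1)
   and x_(-3)): in a simple module they are extremal, and then all weight spaces
   are finite dimensional.

   Let M_0 be finite dimensional.  A weight vector killed by x_(-1) and by all
   x_(-n) with n large is 0 (lower_kernel_eq0).  If moreover M_1 is infinite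
   dimensional, finitely many linear conditions with values in M_0 select a
   nonzero z in M_1 with x_(-1) z = 0.  Computing modulo the vanishing criterion
   above, x_3 x_1^k z is a multiple of x_1^(k+3) z for all k, unless 2 mu + 1 is
   a negative integer, while x_(-1) and x_(-3) lower the powers of x_1.  So the
   submodule generated by z, which is M, meets M_1 in the span of z and its
   parity conjugate, a contradiction.  In the exceptional case the same argument
   applies after the Chevalley involution, to M_0 and M_(-1) or to M_(-1) and
   M_(-2). *)

Set Implicit Arguments.
Unset Strict Implicit.
Unset Printing Implicit Defensive.

Import Order.TTheory GRing.Theory Num.Theory.
Local Open Scope ring_scope.
Local Open Scope complex_scope.

(** * Linear algebra *)

Section FiniteDimension.
Variables (R : realType) (V : lmodType R[i]).
Implicit Types (s : seq V) (U : V -> Prop) (u v : V) (f : {linear V -> V}).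

Lemma subspaceD U u v : subspace U -> U u -> U v -> U (u + v).
Proof. by case=> _ UL Uu Uv; rewrite -[u]scale1r; apply: UL. Qed.

Lemma subspaceZ U a u : subspace U -> U u -> U (a *: u).
Proof. by case=> U0 UL Uu; rewrite -[a *: u]addr0; apply: UL. Qed.

Lemma subspaceB U u v : subspace U -> U u -> U v -> U (u - v).
Proof.
move=> US Uu Uv; apply: subspaceD => //.
by rewrite -scaleN1r; apply: subspaceZ.
Qed.

Lemma subspaceZI U a u : subspace U -> a != 0 -> U (a *: u) -> U u.
Proof.
move=> US a0 Uau; have -> : u = a^-1 *: (a *: u).
  by rewrite scalerA mulVf // scale1r.
exact: subspaceZ.
Qed.

Lemma subspace_eq0 : subspace (fun v : V => v = 0).
Proof. by split=> // a u v -> ->; rewrite scaler0 addr0. Qed.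

Lemma subspace_preim U f : subspace U -> subspace (fun v => U (f v)).
Proof.
case=> U0 UL; split=> [|a u v Uu Uv]; first by rewrite linear0.
by rewrite linearP; apply: UL.
Qed.

Lemma subspace_ker U f : subspace U -> subspace (fun v => U v /\ f v = 0).
Proof.
case=> U0 UL; split=> [|a u v [Uu fu] [Uv fv]]; first by rewrite linear0.
by split; [exact: UL | rewrite linearP fu fv scaler0 addr0].
Qed.

(** Coefficients are peeled off one at a time, so that span arguments go by induction on the list
    instead of manipulating sums over ordinals. *)
Fixpoint in_span s v : Prop :=
  if s is a :: s' then exists c : R[i], in_span s' (v - c *: a) else v = 0.

Lemma in_spanP s v :
  in_span s v <->
  exists a : 'I_(size s) -> R[i], v = \sum_(i < size s) a i *: s`_i.
Proof.
elim: s v => [|b s IH] v /=.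
  split=> [->|[a ->]]; last by rewrite big_ord0.
  by exists (fun=> 0); rewrite big_ord0.
split=> [[c /IH[a E]]|[a ->]].
  exists (fun i => if unlift ord0 i is Some j then a j else c).
  rewrite big_ord_recl unlift_none /=.
  under eq_bigr do rewrite liftK.
  by rewrite -E addrC subrK.
exists (a ord0); apply/IH; exists (fun i => a (lift ord0 i)).
by rewrite big_ord_recl /= addrAC subrr add0r.
Qed.

Lemma in_span_subspace s : subspace (in_span s).
Proof.
elim: s => [|b s IH].
  by split=> // a u v /= -> ->; rewrite scaler0 addr0.
split=> [|a u v [c Hu] [d Hv]].
  by exists 0; rewrite scale0r subr0; case: IH.
exists (a * c + d); have -> : a *: u + v - (a * c + d) *: b
                             = a *: (u - c *: b) + (v - d *: b).
  by rewrite scalerBr scalerA scalerDl opprD addrACA.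
by case: IH => _; apply.
Qed.

Lemma in_span_mem s u : u \in s -> in_span s u.
Proof.
elim: s => //= b s IH; rewrite inE => /predU1P[->|us].
  by exists 1; rewrite scale1r subrr; case: (in_span_subspace s).
by exists 0; rewrite scale0r subr0; apply: IH.
Qed.

Lemma in_span_min s U v :
  subspace U -> (forall u, u \in s -> U u) -> in_span s v -> U v.
Proof.
move=> US; elim: s v => [|b s IH] v /= sU; first by move=> ->; case: US.
case=> c /IH Uv; rewrite -(subrK (c *: b) v); apply: subspaceD => //.
  by apply: Uv => u us; apply: sU; rewrite inE us orbT.
by apply: subspaceZ => //; apply: sU; rewrite mem_head.
Qed.

Lemma in_span_mkseq_min (u : nat -> V) n U v : subspace U ->
  (forall i, (i < n)%N -> U (u i)) -> in_span (mkseq u n) v -> U v.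
Proof.
move=> US Uu; apply: in_span_min => // x /mapP[m]; rewrite mem_iota => /= mn ->.
exact: Uu.
Qed.

Lemma finite_dimP U :
  finite_dim U <->
  exists s, (forall u, u \in s -> U u) /\ forall v, U v -> in_span s v.
Proof.
by split=> -[s [sU Us]]; exists s; split=> // v /Us /in_spanP.
Qed.

(** Induction on the list. If some v0 in U has an image with a nonzero coefficient at the head,
    subtracting multiples of v0 reduces U to the vectors whose image lies in the span of the tail;
    otherwise every image already lies there. *)
Lemma finite_dim_ker f s U : subspace U ->
  (forall u, U u -> in_span s (f u)) ->
  finite_dim (fun u => U u /\ f u = 0) -> finite_dim U.
Proof.
elim: s U => [|b s IH] U US fU finK.
  suff -> : U = (fun u => U u /\ f u = 0) by [].
  by apply/funext => u; apply/propext; split=> [Uu|[]//]; split=> //; exact: fU.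
have [[v0 [c [Uv0 c0 fv0]]]|nex] := pselect (exists v0 c,
    [/\ U v0, c != 0 & in_span s (f v0 - c *: b)]); last first.
  apply: IH => // u Uu; have [c fu] := fU _ Uu.
  have [c0|c0] := eqVneq c 0; first by rewrite c0 scale0r subr0 in fu.
  by case: nex; exists u, c.
have [S0 SL] := in_span_subspace s.
have US' : subspace (fun u => U u /\ in_span s (f u)).
  case: US => U0 UL; split=> [|a u v [Uu fu] [Uv fv]].
    by rewrite linear0.
  by split; [exact: UL | rewrite linearP; exact: SL].
have /finite_dimP[s1 [s1U Us1]] : finite_dim (fun u => U u /\ in_span s (f u)).
  apply: IH => // [u []//|].
  suff -> : (fun u => (U u /\ in_span s (f u)) /\ f u = 0)
          = (fun u => U u /\ f u = 0) by [].
  apply/funext => u; apply/propext; split=> [[[? ?] ?]//|[Uu fu0]].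
  by split=> //; split=> //; rewrite fu0.
apply/finite_dimP; exists (v0 :: s1); split=> [u|v Uv /=].
  by rewrite inE => /predU1P[->|/s1U[]].
have [d fv] := fU _ Uv; exists (d / c); apply: Us1; split.
  by apply: subspaceB => //; apply: subspaceZ.
rewrite linearB linearZ /=.
have -> : f v - (d / c) *: f v0 = (f v - d *: b) - (d / c) *: (f v0 - c *: b).
  rewrite scalerBr scalerA divfK // opprB addrA; congr (_ - _).
  by rewrite subrK.
by apply: subspaceB => //; apply: subspaceZ.
Qed.

Lemma finite_dim_subspace s U :
  subspace U -> (forall u, U u -> in_span s u) -> finite_dim U.
Proof.
move=> US Us; apply: (@finite_dim_ker idfun s) => //.
apply/finite_dimP; exists [::]; split=> // v [_ /= ->] //.
Qed.

Lemma infinite_dim_ker f U T : subspace U -> finite_dim T ->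
  (forall u, U u -> T (f u)) -> ~ finite_dim U ->
  ~ finite_dim (fun u => U u /\ f u = 0).
Proof.
move=> US /finite_dimP[s [_ Ts]] fU infU finK; apply: infU.
by apply: (@finite_dim_ker f s U US _ finK) => u /fU /Ts.
Qed.

Lemma infinite_dim_neq0 U : ~ finite_dim U -> exists2 u, U u & u != 0.
Proof.
move=> infU; apply: contrapT => nex; apply: infU.
apply/finite_dimP; exists [::]; split=> // v Uv /=; apply: contrapT => /eqP v0.
by apply: nex; exists v.
Qed.

(** Gaussian elimination: a term with a nonzero coefficient at the head of the spanning list serves
    as pivot. Only later terms are reduced by it, so a dependency among the reduced terms expresses
    some [u J] through earlier terms, the pivot included. *)
Lemma finite_dim_dependent T (u : nat -> V) : finite_dim T ->
  (forall j, T (u j)) -> exists J, in_span (mkseq u J) (u J).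
Proof.
case/finite_dimP=> s [_ Ts] Tu; have {Ts Tu} : forall j, in_span s (u j).
  by move=> j; apply: Ts.
elim: s u => [|b s IH] u us; first by exists 0%N; exact: (us 0%N).
have [[J0 [c0 [c00 uJ0]]]|nex] :=
    pselect (exists j c, c != 0 /\ in_span s (u j - c *: b)); last first.
  apply: IH => j; have [c uj] := us j.
  have [c0|c0] := eqVneq c 0; first by rewrite c0 scale0r subr0 in uj.
  by case: nex; exists j, c.
have [c uc] := choice us.
pose w j := u (J0.+1 + j)%N - (c (J0.+1 + j)%N / c0) *: u J0.
have SS := in_span_subspace s.
have /IH[J wJ] : forall j, in_span s (w j).
  move=> j; have -> : w j = (u (J0.+1 + j)%N - c (J0.+1 + j)%N *: b)
      - (c (J0.+1 + j)%N / c0) *: (u J0 - c0 *: b).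
    rewrite scalerBr scalerA divfK // opprB addrA; congr (_ - _).
    by rewrite subrK.
  apply: (subspaceB SS); [exact: uc | exact: (subspaceZ _ SS)].
exists (J0.+1 + J)%N.
have SJ := in_span_subspace (mkseq u (J0.+1 + J)).
have um j : (j < J0.+1 + J)%N -> in_span (mkseq u (J0.+1 + J)) (u j).
  by move=> jJ; apply/in_span_mem/mapP; exists j; rewrite ?mem_iota.
have uJ : in_span (mkseq u (J0.+1 + J)) (u J0) by apply: um; rewrite leq_addr.
rewrite -(subrK ((c (J0.+1 + J)%N / c0) *: u J0) (u _)).
apply: (subspaceD SJ); last exact: (subspaceZ _ SJ).
apply: (in_span_mkseq_min SJ _ wJ) => j jJ.
apply: (subspaceB SJ); last exact: (subspaceZ _ SJ).
by apply: um; rewrite ltn_add2l.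
Qed.

End FiniteDimension.

(** * Operators satisfying the Neveu-Schwarz relations *)

(* Over a Z/2-graded module [par] is the parity involution and [par_sign] is -1;
   over an ungraded one they are the identity and 1.  Thus simplicity means the
   same in both cases: there is no proper submodule stable under [par]. *)
Record ns_ops (R : realType) (V : lmodType R[i]) := NsOps {
  opL : int -> {linear V -> V};
  opG : int -> {linear V -> V};
  charge : R[i];
  par : {linear V -> V};
  par_sign : R[i];
  opLL : forall m n v, opL m (opL n v) - opL n (opL m v) =
    (n - m)%:~R *: opL (m + n) v
    - (if m + n == 0 then (m ^+ 3 - m)%:~R / 12%:R * charge else 0) *: v;
  opLG : forall m i v, opL m (opG i v) - opG i (opL m v) =
    (half_shift R i - m%:~R / 2%:R) *: opG (m + i) v;
  opGG : forall i j v, opG i (opG j v) + opG j (opG i v) =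
    2%:R *: opL (i + j + 1) v
    + (if i + j + 1 == 0 then (4%:R * half_shift R i ^+ 2 - 1) / 12%:R * charge
       else 0) *: v;
  par_sign_sq : par_sign * par_sign = 1;
  parK : forall v, par (par v) = v;
  parL : forall n v, par (opL n v) = opL n (par v);
  parG : forall i v, par (opG i v) = par_sign *: opG i (par v);
  ops_simple : forall U : V -> Prop, subspace U ->
    (forall v, U v -> U (opG 0 v)) -> (forall v, U v -> U (opG 1 v)) ->
    (forall v, U v -> U (opG (-1) v)) -> (forall v, U v -> U (opG (-2) v)) ->
    (forall v, U v -> U (par v)) -> trivial_or_full U
}.

Section Operators.
Variables (R : realType) (V : lmodType R[i]).
Implicit Types (r : ns_ops V) (v : V).

Lemma i_sq : 'i * 'i = -1 :> R[i].
Proof. by rewrite -expr2 sqrCi. Qed.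

Let anticommE (x y z : V) : x + y = z -> x = -1 *: y + z.
Proof. by move=> <-; rewrite scaleN1r addrC addrK. Qed.

Let commE (x y z : V) : x - y = z -> x = 1 *: y + z.
Proof. by move=> <-; rewrite scale1r addrC subrK. Qed.

Let comm_symE k (x y z : V) : y - x = k *: z -> x = 1 *: y + (- k) *: z.
Proof. by move=> E; rewrite scaleNr -E scale1r opprB addrC subrK. Qed.

(* [raise r n] and [lower r n] are the generators of degree n/2 and -n/2. *)
Definition raise r (n : nat) : {linear V -> V} :=
  if odd n then opG r (n./2)%:Z else opL r (n./2)%:Z.

Definition lower r (n : nat) : {linear V -> V} :=
  if odd n then opG r (- (n./2)%:Z - 1) else opL r (- (n./2)%:Z).

Definition wt r (z : R[i]) v : Prop := opL r 0 v = z *: v.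

Section Mirror.
Variable r : ns_ops V.
Let L' n : {linear V -> V} := -1 \*: opL r (- n).
(** The factor ['i] has square -1, so anticommutators change sign as the L_n do. If [i] encodes s =
    i + 1/2, then [- i - 1] encodes -s. *)
Let G' i : {linear V -> V} := 'i \*: opG r (- i - 1).

Let L'E n v : L' n v = - opL r (- n) v.
Proof. by rewrite /L' /= scaleN1r. Qed.

Let G'E i v : G' i v = 'i *: opG r (- i - 1) v.
Proof. by []. Qed.

Fact mirror_LL m n v : L' m (L' n v) - L' n (L' m v) =
    (n - m)%:~R *: L' (m + n) v
    - (if m + n == 0 then (m ^+ 3 - m)%:~R / 12%:R * - charge r else 0) *: v.
Proof.
rewrite !L'E !(linearN (opL r _)) /= !opprK opLL.
rewrite (_ : - m - n = - (m + n)) ?oppr_eq0; last by ring.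
rewrite (_ : - n - - m = - (n - m)); last by ring.
rewrite (_ : (- m) ^+ 3 - - m = - (m ^+ 3 - m)); last by ring.
rewrite !rmorphN /= scaleNr scalerN; congr (_ - _ *: _).
by case: ifP => // _; rewrite !mulNr mulrN.
Qed.

Fact mirror_LG m i v : L' m (G' i v) - G' i (L' m v) =
    (half_shift R i - m%:~R / 2%:R) *: G' (m + i) v.
Proof.
rewrite !L'E !G'E (linearN (opG r _)) (linearZ_LR (opL r _)) /=.
rewrite -scalerN -scalerBr opprK addrC -opprB opLG -scaleNr !scalerA.
rewrite (_ : - m + (- i - 1) = - (m + i) - 1); last by ring.
congr (_ *: _); rewrite mulrC; congr (_ * _).
rewrite /half_shift !(rmorphD, rmorphN) /=.
by field.
Qed.

Fact mirror_GG i j v : G' i (G' j v) + G' j (G' i v) =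
    2%:R *: L' (i + j + 1) v
    + (if i + j + 1 == 0
       then (4%:R * half_shift R i ^+ 2 - 1) / 12%:R * - charge r
       else 0) *: v.
Proof.
rewrite !G'E !L'E !(linearZ_LR (opG r _)) /= !scalerA i_sq -scalerDr opGG.
rewrite (_ : - i - 1 + (- j - 1) + 1 = - (i + j + 1)); last by ring.
rewrite oppr_eq0 scaleN1r opprD -scalerN -scaleNr; congr (_ + _ *: _).
case: ifP => _; last by rewrite oppr0.
rewrite /half_shift !(rmorphD, rmorphN) /=.
by field.
Qed.

Fact mirror_parL n v : par r (L' n v) = L' n (par r v).
Proof. by rewrite !L'E linearN parL. Qed.

Fact mirror_parG i v : par r (G' i v) = par_sign r *: G' i (par r v).
Proof. by rewrite !G'E linearZ_LR parG !scalerA mulrC. Qed.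

Fact mirror_simple (U : V -> Prop) : subspace U ->
  (forall v, U v -> U (G' 0 v)) -> (forall v, U v -> U (G' 1 v)) ->
  (forall v, U v -> U (G' (-1) v)) -> (forall v, U v -> U (G' (-2) v)) ->
  (forall v, U v -> U (par r v)) -> trivial_or_full U.
Proof.
move=> US U0 U1 U2 U3; have i0 : ('i : R[i]) != 0 by exact: neq0Ci.
apply: (@ops_simple _ _ r) => // v Uv; apply: (subspaceZI US i0).
- exact: U2.
- exact: U3.
- exact: U0.
- exact: U1.
Qed.

(* The Chevalley involution L_n -> - L_(-n), G_s -> i G_(-s), c -> - c. *)
Definition mirror : ns_ops V :=
  NsOps mirror_LL mirror_LG mirror_GG (par_sign_sq r) (parK r) mirror_parL
    mirror_parG mirror_simple.

Lemma mirror_wt z v : wt mirror z v <-> wt r (- z) v.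
Proof.
rewrite /wt /= oppr0 scaleN1r scaleNr.
by split=> [<-|->]; rewrite opprK.
Qed.

End Mirror.

(** * Commutators of raising and lowering generators *)

Section Relations.
Variable r : ns_ops V.

Lemma lower_comm a b : exists e k : R[i], forall v,
  lower r a (lower r b v) = e *: lower r b (lower r a v) + k *: lower r (a + b) v.
Proof.
rewrite /lower oddD halfD; case: (odd a); case: (odd b) => /=.
- exists (-1), 2%:R => v; apply: anticommE; rewrite opGG ifF ?scale0r ?addr0;
  last by apply/eqP; lia.
  by congr (_ *: opL r _ v); lia.
- exists 1, (- (half_shift R (- (a./2)%:Z - 1) - (- (b./2)%:Z)%:~R / 2%:R)) => v.
  apply: comm_symE; rewrite opLG.
  by congr (_ *: opG r _ v); lia.
- exists 1, (half_shift R (- (b./2)%:Z - 1) - (- (a./2)%:Z)%:~R / 2%:R) => v.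
  apply: commE; rewrite opLG.
  by congr (_ *: opG r _ v); lia.
- exists 1, (- (b./2)%:Z - - (a./2)%:Z)%:~R => v.
  apply: commE; rewrite opLL.
  (* The index sum is 0 only if both generators are L_0, and then the cubic coefficient vanishes. *)
  have -> : (if - (a./2)%:Z - (b./2)%:Z == 0 then
       ((- (a./2)%:Z) ^+ 3 - - (a./2)%:Z)%:~R / 12%:R * charge r else 0) = 0.
    case: ifP => // /eqP ab; have -> : a./2 = 0%N by lia.
    by rewrite oppr0 expr0n /= subrr !mul0r.
  by rewrite scale0r subr0; congr (_ *: opL r _ v); lia.
Qed.

(** The scalar [k] is 2 for n odd and (1 - n/2)/2 for n even. The latter vanishes at n = 2, since
    L_(-1) is the square of G_(-1/2) and commutes with it; hence the bound on n. *)
Lemma lower1_lower n : (2 < n)%N -> exists e k : R[i], k != 0 /\ forall v,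
  lower r 1 (lower r n v) = e *: lower r n (lower r 1 v) + k *: lower r n.+1 v.
Proof.
have nS : n.+1./2 = (odd n + n./2)%N by rewrite -uphalf_half.
rewrite /lower (oddS n) nS => n2.
have := odd_double_half n; case: (odd n) => /= En.
- exists (-1), 2%:R; split=> [|v]; first by rewrite pnatr_eq0.
  apply: anticommE; rewrite opGG ifF ?scale0r ?addr0; last by apply/eqP; lia.
  by congr (_ *: opL r _ v); lia.
- exists 1, (- (half_shift R (-1) - (- (n./2)%:Z)%:~R / 2%:R)); split=> [|v].
    rewrite /half_shift.
    have -> : - ((-1)%:~R + 2%:R^-1 - (- (n./2)%:Z)%:~R / 2%:R)
        = ((1 - n./2%:Z)%:~R / 2%:R : R[i]).
      by rewrite !(rmorphN, rmorphD, rmorph1) /=; field.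
    by rewrite mulf_neq0 ?invr_neq0 ?pnatr_eq0 // intr_eq0; apply/eqP; lia.
  apply: comm_symE; rewrite opLG.
  by congr (_ *: opG r _ v); lia.
Qed.

Lemma lower1_raise n : exists e k : R[i], k != 0 /\ forall v,
  lower r 1 (raise r n.+1 v) = e *: raise r n.+1 (lower r 1 v) + k *: raise r n v.
Proof.
have nS : n.+1./2 = (odd n + n./2)%N by rewrite -uphalf_half.
rewrite /lower /raise (oddS n) nS.
case: (odd n) => /=.
- exists 1, (- (half_shift R (-1) - (1 + (n./2)%:Z)%:~R / 2%:R)); split=> [|v].
    rewrite /half_shift.
    have -> : - ((-1)%:~R + 2%:R^-1 - (1 + (n./2)%:Z)%:~R / 2%:R)
        = ((2 + n./2%:Z)%:~R / 2%:R : R[i]).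
      by rewrite !(rmorphN, rmorphD, rmorph1) /=; field.
    by rewrite mulf_neq0 ?invr_neq0 ?pnatr_eq0 // intr_eq0; apply/eqP; lia.
  apply: comm_symE; rewrite opLG.
  by congr (_ *: opG r _ v); lia.
- exists (-1), 2%:R; split=> [|v]; first by rewrite pnatr_eq0.
  apply: anticommE; rewrite opGG.
  (* At index sum 0 the pair is G_(-1/2), G_(1/2), for which 4 r^2 - 1 = 0: no central term
     appears. *)
  have -> : (if - 0%:Z - 1 + (0%N + n./2)%:Z + 1 == 0 then
      (4%:R * half_shift R (- 0%:Z - 1) ^+ 2 - 1) / 12%:R * charge r else 0) = 0.
    by case: ifP => // _; rewrite /half_shift !(rmorphN, rmorphD, rmorph1) /=; field.
  rewrite scale0r addr0.
  by congr (_ *: opL r _ v); lia.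
Qed.

(** An odd element squares to half of its anticommutator with itself. *)
Lemma lower_sq m : odd m -> exists k : R[i], forall v,
  lower r m (lower r m v) = k *: lower r (m + m) v.
Proof.
move=> om; exists 1 => v; have two0 : (2%:R : R[i]) != 0 by rewrite pnatr_eq0.
apply: (scalerI two0); rewrite scale1r scaler_nat mulr2n.
rewrite /lower addnn odd_double om opGG ifF ?scale0r ?addr0.
  by congr (_ *: opL r _ v); lia.
by apply/eqP; lia.
Qed.

Lemma wt_raise z n v : wt r z v -> wt r (z + n%:R / 2%:R) (raise r n v).
Proof.
rewrite /wt /raise => wv; rewrite -[n in n%:R]odd_double_half natrD.
rewrite -mul2n natrM mulrDl mulrAC mulfV ?pnatr_eq0 // mul1r.
case: (odd n) => /=.
  have /eqP := opLG r 0 n./2 v; rewrite subr_eq add0r wv.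
  rewrite (linearZ_LR (opG r _)) -scalerDl => /eqP ->.
  by congr (_ *: _); rewrite /half_shift /=; field.
have /eqP := opLL r 0 n./2 v; rewrite subr_eq add0r wv.
rewrite (linearZ_LR (opL r _)) => /eqP ->.
rewrite expr0n /= subrr !mul0r if_same scale0r !subr0 -scalerDl.
by rewrite addrC add0r.
Qed.

Lemma wt_lower z n v : wt r z v -> wt r (z - n%:R / 2%:R) (lower r n v).
Proof.
rewrite /wt /lower => wv; rewrite -[n in n%:R]odd_double_half natrD.
rewrite -mul2n natrM mulrDl mulrAC mulfV ?pnatr_eq0 // mul1r.
case: (odd n) => /=.
  have /eqP := opLG r 0 (- (n./2)%:Z - 1) v.
  rewrite subr_eq add0r wv (linearZ_LR (opG r _)) -scalerDl => /eqP ->.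
  by congr (_ *: _); rewrite /half_shift !(rmorphN, rmorphD) /=; field.
have /eqP := opLL r 0 (- (n./2)%:Z) v; rewrite subr_eq add0r wv (linearZ_LR (opL r _)) => /eqP ->.
rewrite expr0n /= subrr !mul0r if_same scale0r !subr0 -scalerDl.
by rewrite addrC rmorphN /= add0r.
Qed.

Lemma Gm1_G0 v : opG r (-1) (opG r 0 v) = 2%:R *: opL r 0 v - opG r 0 (opG r (-1) v).
Proof.
apply/eqP; rewrite -subr_eq opprK opGG /= /half_shift.
suff -> : (4%:R * ((-1)%:~R + 2%:R^-1) ^+ 2 - 1) / 12%:R * charge r = 0 :> R[i].
  by rewrite scale0r addr0.
by field.
Qed.

Lemma G0_G0 v : opG r 0 (opG r 0 v) = opL r 1 v.
Proof.
have two0 : (2%:R : R[i]) != 0 by rewrite pnatr_eq0.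
by apply: (scalerI two0); rewrite scaler_nat mulr2n opGG /= scale0r addr0.
Qed.

Lemma Gm1_Gm1 v : opG r (-1) (opG r (-1) v) = opL r (-1) v.
Proof.
have two0 : (2%:R : R[i]) != 0 by rewrite pnatr_eq0.
by apply: (scalerI two0); rewrite scaler_nat mulr2n opGG /= scale0r addr0.
Qed.

Lemma Gm1_G1 v : opG r (-1) (opG r 1 v)
  = 2%:R *: opG r 0 (opG r 0 v) - opG r 1 (opG r (-1) v).
Proof. by apply/eqP; rewrite -subr_eq opprK opGG /= scale0r addr0 G0_G0. Qed.

Lemma Gm2_G0 v : opG r (-2) (opG r 0 v)
  = 2%:R *: opG r (-1) (opG r (-1) v) - opG r 0 (opG r (-2) v).
Proof. by apply/eqP; rewrite -subr_eq opprK opGG /= scale0r addr0 Gm1_Gm1. Qed.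

Lemma Gm2_G1 v : opG r (-2) (opG r 1 v)
  = 2%:R *: opL r 0 v + (2%:R / 3%:R * charge r) *: v - opG r 1 (opG r (-2) v).
Proof.
apply/eqP; rewrite -subr_eq opprK opGG /= /half_shift; apply/eqP.
by congr (_ + _ *: _); field.
Qed.

End Relations.
End Operators.

(** * Weight spaces and generated submodules *)

Section WeightSpaces.
Variables (R : realType) (V : lmodType R[i]).
Implicit Types (r : ns_ops V) (mu : R[i]) (j k : int) (v : V).

Definition wsp r mu j v : Prop := wt r (mu + j%:~R / 2%:R) v.

Lemma wsp_subspace r mu j : subspace (wsp r mu j).
Proof.
rewrite /wsp /wt; split=> [|a u v wu wv]; first by rewrite linear0 scaler0.
by rewrite linearP wu wv scalerDr !scalerA mulrC.
Qed.

Lemma wsp_raise r mu j n v : wsp r mu j v -> wsp r mu (j + n%:Z) (raise r n v).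
Proof.
move=> /(wt_raise n); rewrite /wsp rmorphD /= mulrDl addrA.
by rewrite -[n%:R]/((n%:Z)%:~R).
Qed.

Lemma wsp_lower r mu j n v : wsp r mu j v -> wsp r mu (j - n%:Z) (lower r n v).
Proof.
move=> /(wt_lower n); rewrite /wsp rmorphB /= mulrBl addrA.
by rewrite -[n%:R]/((n%:Z)%:~R).
Qed.

Lemma wsp_par r mu j v : wsp r mu j v -> wsp r mu j (par r v).
Proof. by rewrite /wsp /wt -parL => ->; rewrite linearZ. Qed.

Lemma mirror_wsp r mu j v : wsp (mirror r) mu j v <-> wsp r (- mu) (- j) v.
Proof.
rewrite /wsp; split=> [/mirror_wt|H]; last apply/mirror_wt; move: H || idtac;
by rewrite opprD rmorphN mulNr.
Qed.

(** Applying L_0 minus its eigenvalue at [k0] removes the head term and multiplies every other term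
    by a nonzero scalar, so induction applies to the tail. *)
Lemma wsp_independent r mu (ks : seq int) (w : int -> V) :
  uniq ks -> (forall k, wsp r mu k (w k)) -> \sum_(k <- ks) w k = 0 ->
  forall k, k \in ks -> w k = 0.
Proof.
elim: ks w => // k0 ks IH w /= /andP[k0ks uks] ww; rewrite big_cons => sum0.
have wks k : k \in ks -> w k = 0.
  move=> kks; pose w' k := ((k - k0)%:~R / 2%:R : R[i]) *: w k.
  have ww' i : wsp r mu i (w' i) by exact/(subspaceZ _ (wsp_subspace _ _ _)).
  have w'E i : w' i = opL r 0 (w i) - (mu + k0%:~R / 2%:R) *: w i.
    by rewrite ww -scalerBl; congr (_ *: _); rewrite rmorphB /=; field.
  have /(IH _ uks ww') : \sum_(k <- ks) w' k = 0.
    have <- : w' k0 + \sum_(k <- ks) w' k = \sum_(k <- ks) w' k.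
      by rewrite /w' subrr mul0r scale0r add0r.
    rewrite w'E; under eq_bigr do rewrite w'E.
    rewrite sumrB -scaler_sumr -linear_sum addrACA -opprD -scalerDr -linearD.
    by rewrite sum0 linear0 scaler0 subrr.
  move=> /(_ k kks) /eqP; rewrite scaler_eq0 mulf_eq0 invr_eq0 pnatr_eq0 orbF.
  rewrite intr_eq0 subr_eq0 => /orP[/eqP kk0|/eqP//].
  by rewrite -kk0 kks in k0ks.
move=> k; rewrite inE => /predU1P[->|/wks//].
by move: sum0; rewrite big_seq big1 ?addr0.
Qed.

(** Grouping the summands by index and subtracting v at index j gives a vanishing sum of weight
    vectors; by independence its term at j is 0. *)
Lemma wsp_component r mu (s : seq (int * V)) j v :
  (forall p, p \in s -> wsp r mu p.1 p.2) -> v = \sum_(p <- s) p.2 ->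
  wsp r mu j v -> v = \sum_(p <- s | p.1 == j) p.2.
Proof.
move=> ws vE wv; pose ks := undup (j :: map fst s).
pose w k := \sum_(p <- s | p.1 == k) p.2 - (if k == j then v else 0).
have ww k : wsp r mu k (w k).
  have WS := wsp_subspace r mu k.
  apply: (subspaceB WS); last by case: eqP => [->//|_]; case: WS.
  rewrite big_seq_cond; elim/big_ind: _ => [|x y|p /andP[ps /eqP <-]].
  - by case: WS.
  - exact: subspaceD.
  - exact: ws.
have jks : j \in ks by rewrite mem_undup mem_head.
have sum_if i (x : V) : i \in ks -> \sum_(k <- ks) (if k == i then x else 0) = x.
  move=> iks; rewrite (bigD1_seq i) ?undup_uniq //= eqxx big1 ?addr0 //.
  by move=> k /negPf->.
have /eqP : w j = 0.
  apply: (wsp_independent (undup_uniq _) ww _ jks).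
  rewrite sumrB sum_if // (exchange_big_dep xpredT) //=.
  apply/eqP; rewrite subr_eq0 vE; apply/eqP; rewrite big_seq [RHS]big_seq.
  apply: eq_bigr => p ps; rewrite big_mkcond -[RHS](sum_if p.1).
    by apply: eq_bigr => k _; rewrite eq_sym.
  by rewrite mem_undup inE map_f ?orbT.
by rewrite /w eqxx subr_eq0 => /eqP->.
Qed.

(** * Submodules generated by families of weight vectors *)

Section Descend.
Variables (r : ns_ops V) (mu : R[i]) (N : int -> V -> Prop).

(** The span of the words in G_(-1/2) and G_(-3/2) applied to [N], with its index. Only lowering
    generators occur, so induction on a derivation can bound the index or trace a vector back to
    [N]. *)
Inductive descend : int -> V -> Prop :=
| descend0 j : descend j 0
| descend_base j v : N j v -> descend j v
| descend_lin j a u v : descend j u -> descend j v -> descend j (a *: u + v)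
| descend1 j v : descend j v -> descend (j - 1) (opG r (-1) v)
| descend3 j v : descend j v -> descend (j - 3) (opG r (-2) v).

Hypothesis Nwt : forall j v, N j v -> wsp r mu j v.
Hypothesis N1 : forall j v, N j v -> descend (j + 1) (opG r 0 v).
Hypothesis N3 : forall j v, N j v -> descend (j + 3) (opG r 1 v).
Hypothesis Npar : forall j v, N j v -> descend j (par r v).

Lemma descend_subspace j : subspace (descend j).
Proof. by split=> [|a u v]; [exact: descend0 | exact: descend_lin]. Qed.

Lemma descend_wsp j v : descend j v -> wsp r mu j v.
Proof.
elim=> [k|//|k a u w _ wu _ ww|k w _ /(wsp_lower 1)//|k w _ /(wsp_lower 3)//].
  by case: (wsp_subspace r mu k).
by case: (wsp_subspace r mu k) => _; apply.
Qed.

Lemma descend_raise1 j v : descend j v -> descend (j + 1) (opG r 0 v).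
Proof.
elim=> [k|k w /N1//|k a u w _ wu _ ww|k w kw IH|k w kw IH].
- by rewrite linear0; apply: descend0.
- by rewrite linearP; apply: descend_lin.
- have -> : opG r 0 (opG r (-1) w) = 2%:R *: opL r 0 w - opG r (-1) (opG r 0 w).
    by rewrite Gm1_G0 opprB addrC subrK.
  rewrite (descend_wsp kw) subrK; apply: (subspaceB (descend_subspace _)).
    by do !apply: (subspaceZ _ (descend_subspace _)).
  by rewrite -[k](addrK 1); apply: descend1.
have -> : opG r 0 (opG r (-2) w) =
    2%:R *: opG r (-1) (opG r (-1) w) - opG r (-2) (opG r 0 w).
  by rewrite Gm2_G0 opprB addrC subrK.
apply: (subspaceB (descend_subspace _)).
  apply: (subspaceZ _ (descend_subspace _)).
  rewrite (_ : k - 3 + 1 = k - 1 - 1); last by ring.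
  by do 2 apply: descend1.
by rewrite (_ : k - 3 + 1 = k + 1 - 3); [apply: descend3 | ring].
Qed.

(** The anticommutator of G_(3/2) with G_(-1/2) is 2 G_(1/2)^2, which [descend_raise1] handles; with
    G_(-3/2) it is a scalar on weight vectors. *)
Lemma descend_raise3 j v : descend j v -> descend (j + 3) (opG r 1 v).
Proof.
elim=> [k|k w /N3//|k a u w _ wu _ ww|k w kw IH|k w kw IH].
- by rewrite linear0; apply: descend0.
- by rewrite linearP; apply: descend_lin.
- have -> : opG r 1 (opG r (-1) w)
            = 2%:R *: opG r 0 (opG r 0 w) - opG r (-1) (opG r 1 w).
    by rewrite Gm1_G1 opprB addrC subrK.
  apply: (subspaceB (descend_subspace _)).
    apply: (subspaceZ _ (descend_subspace _)).
    rewrite (_ : k - 1 + 3 = k + 1 + 1); last by ring.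
    by do 2 apply: descend_raise1.
  by rewrite (_ : k - 1 + 3 = k + 3 - 1); [apply: descend1 | ring].
have -> : opG r 1 (opG r (-2) w) =
    2%:R *: opL r 0 w + (2%:R / 3%:R * charge r) *: w - opG r (-2) (opG r 1 w).
  by rewrite Gm2_G1 opprB addrC subrK.
rewrite (descend_wsp kw) subrK; apply: (subspaceB (descend_subspace _)).
  apply: (subspaceD (descend_subspace _)).
    by do !apply: (subspaceZ _ (descend_subspace _)).
  exact: (subspaceZ _ (descend_subspace _)).
by rewrite -[k](addrK 3); apply: descend3.
Qed.

Lemma descend_par j v : descend j v -> descend j (par r v).
Proof.
elim=> [k|k w /Npar//|k a u w _ wu _ ww|k w kw IH|k w kw IH].
- by rewrite linear0; apply: descend0.
- by rewrite linearP; apply: descend_lin.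
- rewrite parG; apply: (subspaceZ _ (descend_subspace _)); exact: descend1.
- rewrite parG; apply: (subspaceZ _ (descend_subspace _)); exact: descend3.
Qed.

(* [descend] is a graded submodule: the commutators of a raising with a
   lowering generator only involve products of generators of lower degree. *)
Lemma descend_full j0 v0 : N j0 v0 -> v0 != 0 ->
  forall j v, wsp r mu j v -> descend j v.
Proof.
move=> Nv0 v00.
pose T v := exists2 s : seq (int * V),
  forall p, p \in s -> descend p.1 p.2 & v = \sum_(p <- s) p.2.
have T1 k v : descend k v -> T v.
  move=> kv; exists [:: (k, v)]; last by rewrite big_seq1.
  by move=> p; rewrite inE => /eqP->.
have TS : subspace T.
  split=> [|a _ _ [s sd ->] [t td ->]].
    by exists [::]; rewrite ?big_nil.
  exists ([seq (p.1, a *: p.2) | p <- s] ++ t).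
    move=> p; rewrite mem_cat => /orP[/mapP[q /sd qd ->]|/td//].
    exact: (subspaceZ _ (descend_subspace _)).
  by rewrite big_cat big_map scaler_sumr.
have Tsum (f : {linear V -> V}) :
    (forall k v, descend k v -> T (f v)) -> forall v, T v -> T (f v).
  move=> fT _ [s sd ->]; rewrite linear_sum big_seq.
  elim/big_ind: _ => [|x y|p /sd/fT//]; first by case: TS.
  exact: subspaceD.
have [Tz|Tall] : trivial_or_full T.
  apply: (@ops_simple _ _ r) => //; apply: Tsum => k v kv.
  - exact/T1/descend_raise1/kv.
  - exact/T1/descend_raise3/kv.
  - exact/T1/descend1/kv.
  - exact/T1/descend3/kv.
  - exact/T1/descend_par/kv.
- by case/eqP: v00; apply: Tz; apply/T1/descend_base/Nv0.
move=> j v wv; have [s sd vE] := Tall v.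
rewrite (wsp_component _ vE wv) => [|p /sd/descend_wsp//].
rewrite big_seq_cond; elim/big_ind: _ => [|x y|p /andP[/sd pd /eqP<-]//].
  exact: descend0.
exact: (subspaceD (descend_subspace _)).
Qed.

End Descend.

Lemma opG_par_eq0 r i v : opG r i v = 0 -> opG r i (par r v) = 0.
Proof.
by move=> v0; apply: (can_inj (parK r)); rewrite parG parK v0 scaler0 linear0.
Qed.

(** G_(1/2) and G_(3/2) kill y and its parity conjugate, so the module is spanned by lowering words
    on these two vectors. Hence nothing lives above j, and each other weight space is built from
    those one and three steps higher. *)
Lemma highest_weight_finite_dim r mu j y : wsp r mu j y -> y != 0 ->
  opG r 0 y = 0 -> opG r 1 y = 0 -> forall k, finite_dim (wsp r mu k).
Proof.
move=> wy y0 y1 y3.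
pose N i v := i = j /\ in_span [:: y; par r y] v.
have Y U : subspace U -> U y -> U (par r y) ->
    forall v, in_span [:: y; par r y] v -> U v.
  by move=> US Uy Upy v; apply: in_span_min => // u; rewrite !inE => /orP[]/eqP->.
have kerG i v : opG r i y = 0 -> in_span [:: y; par r y] v -> opG r i v = 0.
  move=> yi; apply: (Y _ (subspace_preim (opG r i) (subspace_eq0 V))) => //.
  exact: opG_par_eq0.
have Nwt i v : N i v -> wsp r mu i v.
  case=> ->; move: v; apply: Y => //; [exact: wsp_subspace | exact: wsp_par].
have N1 i v : N i v -> descend r N (i + 1) (opG r 0 v).
  by case=> _ /(kerG _ _ y1)->; apply: descend0.
have N3 i v : N i v -> descend r N (i + 3) (opG r 1 v).
  by case=> _ /(kerG _ _ y3)->; apply: descend0.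
have YS := in_span_subspace [:: y; par r y].
have Npar i v : N i v -> descend r N i (par r v).
  case=> -> vY; apply: descend_base; split=> //; move: v vY.
  apply: (Y _ (subspace_preim (par r) YS)); last rewrite parK; apply: in_span_mem.
    by rewrite !inE eqxx orbT.
  by rewrite inE eqxx.
have Ny : N j y by split=> //; apply: in_span_mem; rewrite inE eqxx.
have full := descend_full Nwt N1 N3 Npar Ny y0.
have high i v : descend r N i v -> j < i -> v = 0.
  elim=> [//|k w []|k a u w _ IHu _ IHw jk|k w _ IH jk|k w _ IH jk].
  - by move=> ->; rewrite ltxx.
  - by rewrite IHu // IHw // scaler0 addr0.
  - by rewrite IH ?linear0 //; lia.
  - by rewrite IH ?linear0 //; lia.
have step i v : descend r N i v -> exists a b1 b3,
    [/\ in_span [:: y; par r y] a, descend r N (i + 1) b1,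
        descend r N (i + 3) b3 & v = a + (opG r (-1) b1 + opG r (-2) b3)].
  have S0 : in_span [:: y; par r y] 0 by case: YS.
  have D0 k : descend r N k 0 by apply: descend0.
  elim=> [k|k w [_ wY]|k a u w _ [x [b1 [b3 [xY b1d b3d ->]]]]
          _ [x' [b1' [b3' [xY' b1d' b3d' ->]]]]|k w kw _|k w kw _].
  - by exists 0, 0, 0; rewrite !linear0 !addr0.
  - by exists w, 0, 0; rewrite !linear0 !addr0.
  - exists (a *: x + x'), (a *: b1 + b1'), (a *: b3 + b3'); split.
    + by case: YS => _; apply.
    + exact: descend_lin.
    + exact: descend_lin.
    + rewrite !linearP /= !scalerDr addrACA; congr (_ + _); exact: addrACA.
  - by exists 0, w, 0; rewrite linear0 add0r addr0 subrK.
  - by exists 0, 0, w; rewrite linear0 !add0r subrK.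
(* Downward induction on the index, n bounding the depth below j + 1; at n = 0 the index exceeds j
   and [high] gives the zero space. *)
have fin n : forall i : int, j + 1 - n%:Z <= i ->
    exists s, forall v, descend r N i v -> in_span s v.
  elim: n => [|n IH] i jn.
    have ji : j < i by lia.
    by exists [::] => v /high; apply.
  have [s1 d1] : exists s, forall v, descend r N (i + 1) v -> in_span s v.
    by apply: IH; lia.
  have [s3 d3] : exists s, forall v, descend r N (i + 3) v -> in_span s v.
    by apply: IH; lia.
  pose s := [:: y; par r y] ++ ([seq opG r (-1) x | x <- s1]
                                ++ [seq opG r (-2) x | x <- s3]).
  exists s => v /step[a [b1 [b3 [aY /d1 b1s /d3 b3s ->]]]].
  have SS := in_span_subspace s.
  have preS (f : {linear V -> V}) := subspace_preim f SS.
  do ?[apply: (subspaceD SS)].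
  - by apply: (in_span_min SS _ aY) => u us; apply: in_span_mem; rewrite mem_cat us.
  - apply: (in_span_min (preS _) _ b1s) => u us; apply: in_span_mem.
    by rewrite !mem_cat (map_f _ us) orbT.
  - apply: (in_span_min (preS _) _ b3s) => u us; apply: in_span_mem.
    by rewrite !mem_cat [X in [|| _, _ | X]](map_f _ us) !orbT.
move=> k; have [s ks] : exists s, forall v, descend r N k v -> in_span s v.
  have jk : j + 1 - (absz (j + 1 - k)%R)%:Z <= k by lia.
  exact: fin jk.
apply: (finite_dim_subspace (wsp_subspace r mu k)) => v /full; exact: ks.
Qed.

End WeightSpaces.

(** * Vanishing criteria *)

Section NoExtremal.
Variables (R : realType) (V : lmodType R[i]).
Implicit Types (r : ns_ops V) (mu : R[i]) (j k : int) (v : V).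

Lemma no_highest_weight r mu k0 : ~ finite_dim (wsp r mu k0) ->
  forall j y, wsp r mu j y -> opG r 0 y = 0 -> opG r 1 y = 0 -> y = 0.
Proof.
move=> inf j y wy y1 y3; apply: contrapT => /eqP y0; apply: inf.
exact: highest_weight_finite_dim wy y0 y1 y3 k0.
Qed.

Lemma wsp_mirror r mu j : wsp (mirror r) mu j = wsp r (- mu) (- j).
Proof. by apply/funext => v; apply/propext; apply: mirror_wsp. Qed.

Lemma no_lowest_weight r mu k0 : ~ finite_dim (wsp r mu k0) ->
  forall j y, wsp r mu j y -> opG r (-1) y = 0 -> opG r (-2) y = 0 -> y = 0.
Proof.
rewrite -[mu]opprK -[k0]opprK -wsp_mirror => inf j y.
rewrite -[j]opprK -wsp_mirror => wy y1 y3.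
by apply: (no_highest_weight inf wy); rewrite /= ?y1 ?y3 scaler0.
Qed.

End NoExtremal.

Section LowerKernel.
Variables (R : realType) (V : lmodType R[i]) (r : ns_ops V) (mu : R[i]).
Hypothesis fin0 : finite_dim (wsp r mu 0).
Variable k0 : int.
Hypothesis inf : ~ finite_dim (wsp r mu k0).
Implicit Types (j : int) (v : V).

(** As G_(-1/2) kills v, each application of it to [raise r n v] leaves only the commutator, which
    is one degree lower with a nonzero coefficient. *)
Lemma iter_lower1_raise n e v : opG r (-1) v = 0 -> (0 < e <= n)%N ->
  exists2 k : R[i], k != 0 &
    iter (n - e) (opG r (-1)) (raise r n v) = k *: raise r e v.
Proof.
move=> v0; elim: n => [|n IH] /andP[e0 en]; first by lia.
have [->|en'] := eqVneq e n.+1.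
  by exists 1; rewrite ?oner_eq0 // subnn scale1r.
have [|k k0' IHk] := IH; first by lia.
have [a [b [b0 E]]] := lower1_raise r n.
exists (b * k); first by rewrite mulf_neq0.
rewrite subSn; last by lia.
rewrite iterSr -[opG r (-1) (raise r n.+1 v)]/(lower r 1 (raise r n.+1 v)).
rewrite E [lower r 1 v]v0 linear0 scaler0 add0r -scalerA -IHk.
by elim: (n - e)%N => //= m ->; rewrite linearZ.
Qed.

Lemma iter_lower1_raise_eq0 n e v : opG r (-1) v = 0 -> (n < e)%N ->
  iter e (opG r (-1)) (raise r n v) = 0.
Proof.
move=> v0; elim: n e => [|n IH] [|e] // ne; rewrite iterSr.
  (* [raise r 0 v] is L_0 v, and [L_0, G_(-1/2)] is a multiple of G_(-1/2). *)
  have -> : opG r (-1) (raise r 0 v) = 0.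
    have v0' : opG r (0 - 1) v = 0 by rewrite sub0r.
    rewrite /raise /=; have /eqP := opLG r 0 (-1) v.
    by rewrite v0' linear0 scaler0 sub0r oppr_eq0 => /eqP.
  by elim: e {ne} => //= m ->; rewrite linear0.
have [a [b [b0 E]]] := lower1_raise r n.
rewrite -[opG r (-1) (raise r n.+1 v)]/(lower r 1 (raise r n.+1 v)).
rewrite E [lower r 1 v]v0 linear0 scaler0 add0r.
have -> : iter e (opG r (-1)) (b *: raise r n v)
        = b *: iter e (opG r (-1)) (raise r n v).
  by elim: (e) => //= m ->; rewrite linearZ.
by rewrite IH ?scaler0.
Qed.

Lemma wsp_iter_lower m n j v : wsp r mu j v ->
  wsp r mu (j - (n * m)%:Z) (iter n (lower r m) v).
Proof.
move=> wv; elim: n => [|n IH]; first by rewrite mul0n subr0.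
rewrite iterS (_ : j - (n.+1 * m)%:Z = j - (n * m)%:Z - m%:Z); last by lia.
exact: wsp_lower.
Qed.

(* Suitable raising operators map the iterates of v into the finite dimensional
   weight space of index 0, where their images are linearly dependent.  Applying
   a power of G_(-1/2) to a dependency relation leaves only its last term, so
   the corresponding iterate is a highest weight vector or 0. *)
Lemma iter_lower_eq0 m j v : (3 < m)%N -> wsp r mu j v ->
  (forall n, opG r (-1) (iter n (lower r m) v) = 0) ->
  exists n, iter n (lower r m) v = 0.
Proof.
(* The vector [s i] has index j - (i0 + i) m, and [K i] is the degree that brings it back to index
   0. The shift [i0] makes every [K i] at least 3. *)
move=> m3 wv v1; pose i0 := (absz j + 3)%N.
pose s i := iter (i0 + i) (lower r m) v.
pose K i := absz ((i0 + i)%N * m - j).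
have KE i : (K i)%:Z = (i0 + i)%:Z * m%:Z - j by rewrite /K; nia.
have K3 i : (3 <= K i)%N by have := KE i; nia.
have [|J dep] := finite_dim_dependent (u := fun i => raise r (K i) (s i)) fin0.
  move=> i; have := wsp_raise (K i) (wsp_iter_lower m (i0 + i) wv).
  by rewrite KE PoszM subrKA addrN.
have kerJ e : (0 < e <= 3)%N -> raise r e (s J) = 0.
  move=> /andP[e0 e3].
  have [|k k0' kE] := iter_lower1_raise (n := K J) (e := e) (v1 (i0 + J)%N).
    by rewrite e0 (leq_trans e3).
  have US : subspace (fun w => iter (K J - e) (opG r (-1)) w = 0).
    elim: (K J - e)%N => [|n IH]; first exact: subspace_eq0.
    have -> : (fun w => iter n.+1 (opG r (-1)) w = 0)
            = (fun w => iter n (opG r (-1)) (opG r (-1) w) = 0).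
      by apply/funext => w; rewrite iterSr.
    exact: (subspace_preim (opG r (-1)) IH).
  have : iter (K J - e) (opG r (-1)) (raise r (K J) (s J)) = 0.
    apply: (in_span_mkseq_min US _ dep) => i iJ.
    (* Consecutive values of [K] differ by m > 3 >= e, so [K J - e] still exceeds every earlier
       [K i]. *)
    apply: iter_lower1_raise_eq0; first exact: v1.
    by have := KE i; have := KE J; nia.
  by rewrite kE => /eqP; rewrite scaler_eq0 (negPf k0') => /eqP.
exists (i0 + J)%N; apply: (no_highest_weight inf (wsp_iter_lower m (i0 + J) wv)).
  exact: (kerJ 1%N).
exact: (kerJ 3%N).
Qed.

(** Induction on the bound. If x_(-m) kills v for all m > n and n <= 2, then v is lowest. For n > 2,
    x_(-n) preserves the hypotheses, and it suffices that it kills v. For n odd its square is a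
    multiple of x_(-2n), which kills v; for n even some power of it kills v by [iter_lower_eq0], and
    the factors are removed one by one. *)
Lemma lower_kernel_eq0 n j v : wsp r mu j v -> opG r (-1) v = 0 ->
  (forall m, (n <= m)%N -> lower r m v = 0) -> v = 0.
Proof.
elim: n j v => [|n IH] j v wv v1 vn.
  apply: (no_lowest_weight inf wv) => //; exact: (vn 3%N).
have [n3|n3] := leqP n 2.
  apply: (no_lowest_weight inf wv) => //; exact: (vn 3%N).
have killed w : opG r (-1) w = 0 -> (forall m, (n < m)%N -> lower r m w = 0) ->
    forall m, (n < m)%N -> lower r m (lower r n w) = 0.
  move=> w1 wn m nm; have [a [b ->]] := lower_comm r m n.
  by rewrite !wn ?linear0 ?scaler0 ?addr0 //; lia.
have killed1 w : opG r (-1) w = 0 -> (forall m, (n < m)%N -> lower r m w = 0) ->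
    opG r (-1) (lower r n w) = 0.
  move=> w1 wn; have [a [b [_ E]]] := lower1_lower r n3.
  rewrite -[opG r (-1) (lower r n w)]/(lower r 1 (lower r n w)) E.
  by rewrite [lower r 1 w]w1 wn // linear0 !scaler0 addr0.
have IH' i w : wsp r mu i w -> opG r (-1) w = 0 ->
    (forall m, (n < m)%N -> lower r m w = 0) -> lower r n w = 0 -> w = 0.
  move=> ww w1 wn wn0; apply: (IH i) => // m; rewrite leq_eqVlt => /predU1P[<-//|].
  exact: wn.
have [on|en] := boolP (odd n).
  apply: (IH' j) => //; apply: (IH' (j - n%:Z)).
  - exact: wsp_lower.
  - exact: killed1.
  - exact: killed.
  - have [a ->] := lower_sq r on; rewrite vn ?scaler0 //; lia.
have iter_killed i : opG r (-1) (iter i (lower r n) v) = 0 /\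
    forall m, (n < m)%N -> lower r m (iter i (lower r n) v) = 0.
  by elim: i => [//|i [H1 H2]]; split; [exact: killed1 | exact: killed].
have n4 : (3 < n)%N by case: (n) n3 en => [|[|[|[|]]]].
have [|l] := iter_lower_eq0 n4 wv; first by move=> l; case: (iter_killed l).
elim: l => // l IHl /= vl0; apply: IHl.
have [H1 H2] := iter_killed l.
exact: (IH' _ _ (wsp_iter_lower n l wv)).
Qed.

(* Given G_(-1/2) v = 0, the vector G_(-1/2)^e G_(-3/2) v is a nonzero multiple
   of the lowering operator of degree 3 + e applied to v. *)
Lemma lower_kernel_eq0_of_iter e j v : wsp r mu j v -> opG r (-1) v = 0 ->
  iter e (opG r (-1)) (opG r (-2) v) = 0 -> v = 0.
Proof.
move=> wv v1 ve.
have lowerE m : exists k : R[i],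
    lower r (3 + m) v = k *: iter m (opG r (-1)) (opG r (-2) v).
  elim: m => [|m [k IH]]; first by exists 1; rewrite scale1r.
  have [|a [b [b0 E]]] := @lower1_lower _ _ r (3 + m); first by lia.
  exists (b^-1 * k); rewrite addnS iterS -scalerA -[k *: _]linearZ -IH.
  rewrite -[opG r (-1) (lower r (3 + m) v)]/(lower r 1 (lower r (3 + m) v)) E.
  by rewrite [lower r 1 v]v1 linear0 scaler0 add0r scalerA mulVf // scale1r.
apply: (lower_kernel_eq0 (n := 3 + e) wv v1) => m em.
have [k E] := lowerE (m - 3)%N; rewrite -[m](subnKC (_ : 3 <= m)%N); last by lia.
rewrite E -[(m - 3)%N](subnK (_ : e <= m - 3)%N); last by lia.
rewrite iterD ve; have -> : forall i, iter i (opG r (-1)) 0 = 0.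
  by elim=> //= i ->; rewrite linear0.
by rewrite scaler0.
Qed.

(** Commuting with G_(-1/2) passes from the vanishing of x_(-n) v to that of x_(-n-1) v, hence to
    all higher degrees. *)
Lemma lower_kernel_eq0_of_lower n j v : (2 < n)%N -> wsp r mu j v ->
  opG r (-1) v = 0 -> lower r n v = 0 -> v = 0.
Proof.
move=> n2 wv v1 vn; apply: (lower_kernel_eq0 (n := n) wv v1) => m.
move/subnKC <-; elim: (m - n)%N => [|i IH]; first by rewrite addn0.
have [|a [b [b0 E]]] := @lower1_lower _ _ r (n + i); first by lia.
have := E v; rewrite IH [lower r 1 v]v1 !linear0 ?scaler0 add0r addnS => /esym/eqP.
by rewrite scaler_eq0 (negPf b0) => /eqP.
Qed.

End LowerKernel.

(** * Strings over lowest vectors *)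

Section Parity.
Variables (R : realType) (V : lmodType R[i]) (r : ns_ops V).
Implicit Types (f : {linear V -> V}) (v : V).

Definition par_homog f := exists a : R[i], forall v, par r (f v) = a *: f (par r v).

Lemma par_homog_comp f1 f2 :
  par_homog f1 -> par_homog f2 -> par_homog (f1 \o f2).
Proof.
by case=> a E [b F]; exists (a * b) => v; rewrite /= E F linearZ scalerA.
Qed.

Lemma par_homog_opG n : par_homog (opG r n).
Proof. by exists (par_sign r) => v; rewrite parG. Qed.

Lemma par_homog_lower n : par_homog (lower r n).
Proof.
rewrite /lower; case: odd; first exact: par_homog_opG.
by exists 1 => v; rewrite parL scale1r.
Qed.

Lemma par_homog_ker f v : par_homog f -> f v = 0 -> f (par r v) = 0.
Proof.
by case=> a E fv; apply: (can_inj (parK r)); rewrite E parK fv scaler0 linear0.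
Qed.

End Parity.

Section LowestStrings.
Variables (R : realType) (V : lmodType R[i]) (r : ns_ops V) (mu : R[i]).
Hypothesis fin0 : finite_dim (wsp r mu 0).
Hypothesis inf1 : ~ finite_dim (wsp r mu 1).
Hypothesis generic : forall n : nat, (0 < n)%N -> 2%:R * mu + 1 + n%:R != 0.
Implicit Types (j k n : nat) (z v : V).

Fixpoint gpow k : {linear V -> V} :=
  if k is k'.+1 then (opG r 0 \o gpow k')%FUN else idfun.

(* [low_coef] is defined by G_(-1/2) G_(1/2)^k z = low_coef k G_(1/2)^(k-1) z,
   and [hcoef] by G_(3/2) G_(1/2)^k z = hcoef k G_(1/2)^(k+3) z. *)
Fixpoint low_coef k : R[i] :=
  if k is k'.+1 then 2%:R * mu + 1 + k'%:R - low_coef k' else 0.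

Fixpoint hcoef k : R[i] :=
  if k is k'.+1 then (2%:R - low_coef k * hcoef k') / low_coef k.+3
  else 2%:R / low_coef 3.

Definition defect k : {linear V -> V} :=
  (opG r 1 \o gpow k) \- (hcoef k \*: gpow k.+3).

Lemma gpowS k v : gpow k.+1 v = opG r 0 (gpow k v).
Proof. by []. Qed.

Lemma defectE k v : defect k v = opG r 1 (gpow k v) - hcoef k *: gpow k.+3 v.
Proof. by []. Qed.

Lemma low_coefE j :
  low_coef j.*2 = j%:R /\ low_coef j.*2.+1 = 2%:R * mu + 1 + j%:R.
Proof.
elim: j => [|j [IH1 IH2]]; first by split=> //=; rewrite subr0.
have E : low_coef j.+1.*2 = j.+1%:R.
  rewrite doubleS -[low_coef _]/(2%:R * mu + 1 + j.*2.+1%:R - low_coef j.*2.+1).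
  by rewrite IH2 -addnn -!natr1 natrD; ring.
split=> //; rewrite -[LHS]/(2%:R * mu + 1 + j.+1.*2%:R - low_coef j.+1.*2).
by rewrite E -addnn natrD; ring.
Qed.

(** By the closed form, even k gives k/2 and odd k gives 2 mu + 1 + (k-1)/2, which is nonzero by
    [generic]. The bound on k leaves out 2 mu + 1 itself. *)
Lemma low_coef_neq0 k : (1 < k)%N -> low_coef k != 0.
Proof.
move=> k1; rewrite -(odd_double_half k).
case: (odd k) (odd_double_half k) => kE; last first.
  by rewrite add0n (low_coefE _).1 pnatr_eq0; lia.
by rewrite add1n (low_coefE _).2; apply: generic; lia.
Qed.

(** This is what makes G_(-1/2) kill [defect k z] once the relation holds at k - 1. At k = 0 the
    default [hcoef k.-1] is multiplied by [low_coef 0], which is 0. *)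
Lemma hcoefE k : hcoef k * low_coef k.+3 = 2%:R - low_coef k * hcoef k.-1.
Proof.
have L3 n : low_coef n.+3 != 0 by exact: low_coef_neq0.
case: k => [|k]; last exact: (divfK (L3 _)).
by rewrite [low_coef 0]/= mul0r subr0; apply: (divfK (L3 _)).
Qed.

Lemma par_homog_gpow k : par_homog r (gpow k).
Proof.
elim: k => [|k IH]; first by exists 1 => v; rewrite scale1r.
exact: par_homog_comp (par_homog_opG r 0) IH.
Qed.

Lemma par_homog_defect k : par_homog r (defect k).
Proof.
have [a E] := par_homog_gpow k; exists (par_sign r * a) => v.
have E3 : par r (gpow k.+3 v) = (par_sign r * a) *: gpow k.+3 (par r v).
  rewrite !gpowS !parG E !(linearZ_LR (opG r 0)) !scalerA !mulrA par_sign_sq.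
  by rewrite mul1r.
rewrite !defectE (linearB (par r)) (linearZ_LR (par r)) parG E E3.
by rewrite (linearZ_LR (opG r 1)) scalerBr !scalerA [hcoef k * _]mulrC.
Qed.

(* The four conditions take place in the weight space of index 0. *)
Definition good_lowest z : Prop :=
  ((((wsp r mu 1 z /\ opG r (-1) z = 0)
    /\ (opG r (-2) \o gpow 2)%FUN z = 0)
   /\ (lower r 4 \o defect 0)%FUN z = 0)
  /\ (lower r 5 \o defect 1)%FUN z = 0).

Lemma wsp_gpow k z : wsp r mu 1 z -> wsp r mu k.+1 (gpow k z).
Proof.
move=> wz; elim: k => //= k /(wsp_raise 1).
by rewrite (_ : k.+1%:Z + 1%N = k.+2) //; lia.
Qed.

Lemma wsp_defect k z : wsp r mu 1 z -> wsp r mu k.+4 (defect k z).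
Proof.
move=> wz; have WS := wsp_subspace r mu k.+4; apply: (subspaceB WS).
  have := wsp_raise 3 (wsp_gpow k wz).
  by rewrite (_ : k.+1%:Z + 3%N = k.+4) //; lia.
by apply: (subspaceZ _ WS); apply: wsp_gpow.
Qed.

Lemma good_lowest_subspace : subspace good_lowest.
Proof. by do 4 apply: subspace_ker; apply: wsp_subspace. Qed.

Lemma good_lowest_par z : good_lowest z -> good_lowest (par r z).
Proof.
case=> [[[[wz z1] z2] z3] z4]; split; last first.
  apply: par_homog_ker z4; apply: par_homog_comp (par_homog_defect 1).
  exact: par_homog_lower.
split; last first.
  apply: par_homog_ker z3; apply: par_homog_comp (par_homog_defect 0).
  exact: par_homog_lower.
split; last first.
  apply: par_homog_ker z2; apply: par_homog_comp (par_homog_gpow 2).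
  exact: par_homog_opG.
split; first exact: wsp_par.
exact: (par_homog_ker (par_homog_opG r (-1))).
Qed.

(** Each condition cuts an infinite dimensional space by a map into the finite dimensional space of
    index 0: the indices are 1 - 1, 1 + 2 - 3, 4 - 4 and 5 - 5. *)
Lemma good_lowest_infinite : ~ finite_dim good_lowest.
Proof.
have WS := wsp_subspace r mu 1.
have K1 := subspace_ker (opG r (-1)) WS.
have K2 := subspace_ker (opG r (-2) \o gpow 2) K1.
have K3 := subspace_ker (lower r 4 \o defect 0) K2.
apply: (infinite_dim_ker (T := wsp r mu 0) K3) => // [z [[[wz _] _] _]|].
  exact: (wsp_lower 5 (wsp_defect 1 wz)).
apply: (infinite_dim_ker (T := wsp r mu 0) K2) => // [z [[wz _] _]|].
  exact: (wsp_lower 4 (wsp_defect 0 wz)).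
apply: (infinite_dim_ker (T := wsp r mu 0) K1) => // [z [wz _]|].
  exact: (wsp_lower 3 (wsp_gpow 2 wz)).
apply: (infinite_dim_ker (T := wsp r mu 0) WS) => // z wz.
exact: (wsp_lower 1 wz).
Qed.

Section String.
Variable z : V.
Hypothesis good_z : good_lowest z.

Let wz : wsp r mu 1 z. Proof. by case: good_z => [[[[]]]]. Qed.
Let z1 : opG r (-1) z = 0. Proof. by case: good_z => [[[[]]]]. Qed.
Let z2 : opG r (-2) (gpow 2 z) = 0. Proof. by case: good_z => [[[]]]. Qed.

Lemma Gm1_gpow k : opG r (-1) (gpow k z) = low_coef k *: gpow k.-1 z.
Proof.
elim: k => [|k IH]; first by rewrite /= z1 scale0r.
rewrite [LHS]/= Gm1_G0 IH.
have wk : opL r 0 (gpow k z) = (mu + k.+1%:R / 2%:R) *: gpow k z := wsp_gpow k wz.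
(* At k = 0 the predecessor is 0 again, but [low_coef 0] makes both sides vanish. *)
have -> : opG r 0 (low_coef k *: gpow k.-1 z) = low_coef k *: gpow k z.
  by case: k {IH wk} => [|k]; rewrite linearZ //= !scale0r.
rewrite wk scalerA -scalerBl; congr (_ *: _).
by rewrite /= -natr1; field.
Qed.

(** The anticommutator of G_(-3/2) with G_(1/2) is 2 G_(-1/2)^2, which lowers powers of G_(1/2) by
    [Gm1_gpow]; the induction starts from the second condition on z. *)
Lemma Gm2_gpow k : exists a : R[i], opG r (-2) (gpow k.+3 z) = a *: gpow k z.
Proof.
have E n : opG r (-2) (gpow n.+1 z) = 2%:R *: opG r (-1) (opG r (-1) (gpow n z))
    - opG r 0 (opG r (-2) (gpow n z)) by rewrite Gm2_G0.
elim: k => [|k [a IH]];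
  rewrite E Gm1_gpow (linearZ_LR (opG r (-1))) Gm1_gpow !scalerA.
  by rewrite z2 linear0 subr0; eexists.
by rewrite IH (linearZ_LR (opG r 0)) -gpowS -scalerBl; eexists.
Qed.

Lemma iterZ (f : {linear V -> V}) n (a : R[i]) v :
  iter n f (a *: v) = a *: iter n f v.
Proof. by elim: n => //= n ->; rewrite (linearZ_LR f). Qed.

Lemma iter_Gm1_gpow k : iter k.+1 (opG r (-1)) (gpow k z) = 0.
Proof.
elim: k => [|k IH]; rewrite iterSr Gm1_gpow; first by rewrite scale0r.
by rewrite iterZ [k.+1.-1]/= IH scaler0.
Qed.

(** Strong induction. By [hcoefE], G_(-1/2) kills the defect, so a vanishing criterion suffices. For
    k = 0 and 1 it is supplied by the last two conditions on z. For k >= 2, G_(-3/2) sends the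
    defect to a multiple of [gpow k z], which a power of G_(-1/2) kills. *)
Lemma defect_eq0 k : defect k z = 0.
Proof.
have [n] := ubnP k; elim: n k => // n IH k kn.
have hE j : (j < k)%N -> opG r 1 (gpow j z) = hcoef j *: gpow j.+3 z.
  by move=> jk; apply/eqP; rewrite -subr_eq0 -defectE IH //; lia.
have hp : opG r 1 (low_coef k *: gpow k.-1 z)
        = (low_coef k * hcoef k.-1) *: gpow k.+2 z.
  rewrite (linearZ_LR (opG r 1)) -scalerA; case: (k) hE => [|j] hE.
    by rewrite [low_coef 0]/= !scale0r.
  by rewrite hE.
have d1 : opG r (-1) (defect k z) = 0.
  rewrite defectE (linearB (opG r (-1))) (linearZ_LR (opG r (-1))) Gm1_G1.
  rewrite !Gm1_gpow scalerA hcoefE hp -[opG r 0 (opG r 0 _)]/(gpow k.+2 z).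
  by rewrite -scalerBl subrr.
have wd := wsp_defect k wz.
case: k kn hE hp d1 wd => [|[|k]] kn hE hp d1 wd.
- apply: (lower_kernel_eq0_of_lower fin0 inf1 (n := 4) _ wd d1) => //.
  by case: good_z => [[_]].
- apply: (lower_kernel_eq0_of_lower fin0 inf1 (n := 5) _ wd d1) => //.
  by case: good_z.
apply: (lower_kernel_eq0_of_iter fin0 inf1 (e := k.+3) wd d1).
have hm : exists a : R[i], opG r 1 (opG r (-2) (gpow k.+2 z)) = a *: gpow k.+2 z.
  case: k {hp wd d1 kn} hE => [|k] hE.
    by exists 0; rewrite z2 linear0 scale0r.
  have [a ->] := Gm2_gpow k; exists (a * hcoef k).
  by rewrite (linearZ_LR (opG r 1)) hE ?scalerA //; lia.
have wk : opL r 0 (gpow k.+2 z) = (mu + k.+3%:R / 2%:R) *: gpow k.+2 z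
  := wsp_gpow k.+2 wz.
have [a hmE] := hm; have [b g3E] := Gm2_gpow k.+2.
suff [c ->] : exists c : R[i], opG r (-2) (defect k.+2 z) = c *: gpow k.+2 z.
  by rewrite iterZ iter_Gm1_gpow scaler0.
rewrite defectE (linearB (opG r (-2))) (linearZ_LR (opG r (-2))) Gm2_G1 wk hmE.
rewrite g3E !scalerA -scalerDl -!scalerBl; by eexists.
Qed.

End String.

(* A good lowest vector generates a submodule whose part of positive index is
   spanned by the vectors G_(1/2)^k z and their parity conjugates. *)
Lemma generic_absurd : False.
Proof.
have [z gz z0] := infinite_dim_neq0 good_lowest_infinite.
pose Z := in_span [:: z; par r z].
have ZS : subspace Z := in_span_subspace _.
have Zz : Z z by apply: in_span_mem; rewrite inE eqxx.
have Zpz : Z (par r z) by apply: in_span_mem; rewrite !inE eqxx orbT.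
have Zmin U : subspace U -> U z -> U (par r z) -> forall v, Z v -> U v.
  by move=> US Uz Upz v; apply: in_span_min => // u; rewrite !inE => /orP[]/eqP->.
have Zgood : forall v, Z v -> good_lowest v.
  exact: (Zmin _ good_lowest_subspace gz (good_lowest_par gz)).
have Zpar : forall v, Z v -> Z (par r v).
  by apply: (Zmin _ (subspace_preim (par r) ZS)); rewrite ?parK.
pose N (j : int) v := exists k z', [/\ Z z', j = k.+1 & v = gpow k z'].
have Nwt (j : int) v : N j v -> wsp r mu j v.
  by case=> k [z' [/Zgood[[[[wz' _] _] _] _] -> ->]]; apply: wsp_gpow.
have N1 (j : int) v : N j v -> descend r N (j + 1) (opG r 0 v).
  case=> k [z' [Zz' -> ->]]; apply: descend_base; exists k.+1, z'; split=> //.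
  by lia.
have N3 (j : int) v : N j v -> descend r N (j + 3) (opG r 1 v).
  case=> k [z' [Zz' -> ->]]; apply: descend_base; exists k.+3, (hcoef k *: z').
  split; [exact: (subspaceZ _ ZS) | lia |].
  rewrite (linearZ_LR (gpow k.+3)).
  by apply/eqP; rewrite -subr_eq0 -defectE (defect_eq0 (Zgood _ Zz')).
have Npar (j : int) v : N j v -> descend r N j (par r v).
  case=> k [z' [Zz' -> ->]]; apply: descend_base; have [a ->] := par_homog_gpow k.
  exists k, (a *: par r z'); split=> //; last by rewrite (linearZ_LR (gpow k)).
  by apply: (subspaceZ _ ZS); apply: Zpar.
have Nz : N 1 z by exists 0%N, z.
have full := descend_full Nwt N1 N3 Npar Nz z0.
(* The index only falls along a lowering word, so a word ending at positive index stays there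
   throughout, where [Gm1_gpow] and [Gm2_gpow] keep it in [N]. *)
have pos (j : int) v : descend r N j v -> 0 < j -> N j v.
  elim=> {j v} [j|j v //|j a u v _ IHu _ IHv|j v _ IH|j v _ IH] j0.
  - exists (absz (j - 1)), 0; split; [by case: ZS | lia | by rewrite linear0].
  - have [k [x [Zx jk ->]]] := IHu j0; have [l [y [Zy jl ->]]] := IHv j0.
    have kl : l = k by lia.
    exists k, (a *: x + y); rewrite kl; split=> //; last by rewrite linearP.
    by case: ZS => _; apply.
  - have [|k [x [Zx jk ->]]] := IH; first by lia.
    case: k jk => [|k] jk; first by lia.
    exists k, (low_coef k.+1 *: x); split; [exact: (subspaceZ _ ZS) | lia |].
    by rewrite (Gm1_gpow (Zgood _ Zx)) (linearZ_LR (gpow k)).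
  - have [|k [x [Zx jk ->]]] := IH; first by lia.
    case: k jk => [|[|[|k]]] jk; try lia.
    have [a ->] := Gm2_gpow (Zgood _ Zx) k.
    exists k, (a *: x); split; [exact: (subspaceZ _ ZS) | lia |].
    by rewrite (linearZ_LR (gpow k)).
apply: inf1; apply: (@finite_dim_subspace _ _ [:: z; par r z]) => [|v].
  exact: wsp_subspace.
move=> /full /pos [] // k [z' [Zz' jk ->]].
by have -> : k = 0%N by lia.
Qed.

End LowestStrings.

(** * Modules over the Neveu-Schwarz algebra *)

Section Reduction.
Variables (R : realType) (V : lmodType R[i]).
Implicit Types (r : ns_ops V) (mu : R[i]) (j k : int).

Lemma wsp_shift r mu j k : wsp r (mu + j%:~R / 2%:R) k = wsp r mu (j + k).
Proof.
apply/funext => v; rewrite /wsp rmorphD /=.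
by congr wt; rewrite mulrDl addrA.
Qed.

Lemma adjacent_finite_infinite_absurd r mu :
  finite_dim (wsp r mu 0) -> ~ finite_dim (wsp r mu 1) -> False.
Proof.
move=> fin0 inf1.
have [gen|] := pselect (forall n : nat, (0 < n)%N -> 2%:R * mu + 1 + n%:R != 0).
  exact: (generic_absurd fin0 inf1 gen).
move=> /existsNP [n] /not_implyP [n0] /negP/negPn/eqP mun.
(* Since -2 mu = n + 1, the mirrored expression is a positive integer, both at M_0 (d = 0) and at
   M_(-1) (d = 1). *)
have mirror_generic d m : 2%:R * - (mu + - d%:R / 2%:R) + 1 + m%:R != 0.
  have -> : 2%:R * - (mu + - d%:R / 2%:R) + 1 + m%:R = (n + d + m + 2)%:R.
    by rewrite !natrD -[RHS](subr0 _) -mun; field.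
  by rewrite pnatr_eq0; lia.
have [finN1|infN1] := pselect (finite_dim (wsp r mu (-1))); last first.
  apply: (@generic_absurd _ _ (mirror r) (- mu)).
  - by rewrite wsp_mirror opprK oppr0.
  - by rewrite wsp_mirror opprK.
  - by move=> m _; have := mirror_generic 0%N m; rewrite oppr0 mul0r addr0.
(* Were M_(-2) finite dimensional along with M_0, the infinite dimensional M_1 would contain a
   nonzero vector killed by G_(-1/2) and G_(-3/2). *)
have infN2 : ~ finite_dim (wsp r mu (-2)).
  move=> finN2; have WS := wsp_subspace r mu 1.
  have K1S := subspace_ker (opG r (-1)) WS.
  have K1 := infinite_dim_ker WS fin0 (fun z wz => wsp_lower 1 wz) inf1.
  have K2 := infinite_dim_ker K1S finN2
    (fun z (wz : wsp r mu 1 z /\ opG r (-1) z = 0) => wsp_lower 3 wz.1) K1.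
  have [z [[wz z1] z2] /eqP z0] := infinite_dim_neq0 K2.
  exact/z0/(no_lowest_weight inf1 wz).
apply: (@generic_absurd _ _ (mirror r) (- (mu + (-1)%:~R / 2%:R))).
- by rewrite wsp_mirror opprK wsp_shift.
- by rewrite wsp_mirror opprK wsp_shift.
- by move=> m _; have := mirror_generic 1%N m.
Qed.

(** Finite dimensionality spreads from an index to both neighbours, downward by passing to
    [mirror r], and so to all indices. *)
Lemma finite_infinite_absurd r mu j k :
  finite_dim (wsp r mu j) -> ~ finite_dim (wsp r mu k) -> False.
Proof.
move=> finj; apply; have up l : finite_dim (wsp r mu l) ->
    finite_dim (wsp r mu (l + 1)) /\ finite_dim (wsp r mu (l - 1)).
  move=> finl; split; apply: contrapT => inf.
    apply: (@adjacent_finite_infinite_absurd r (mu + l%:~R / 2%:R)).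
      by rewrite wsp_shift addr0.
    by rewrite wsp_shift.
  apply: (@adjacent_finite_infinite_absurd (mirror r) (- (mu + l%:~R / 2%:R))).
    by rewrite wsp_mirror opprK wsp_shift oppr0 addr0.
  by rewrite wsp_mirror opprK wsp_shift.
have all n : finite_dim (wsp r mu (j + n%:Z)) /\ finite_dim (wsp r mu (j - n%:Z)).
  elim: n => [|n [/up[IH1 _] /up[_ IH2]]]; first by rewrite !addr0.
  rewrite (_ : j + n.+1%:Z = j + n%:Z + 1); last by lia.
  by rewrite (_ : j - n.+1%:Z = j - n%:Z - 1); last by lia.
have [kj|jk] := leP k j.
  rewrite (_ : k = j - (absz (j - k)%R)%:Z); last by lia.
  by case: (all (absz (j - k)%R)).
rewrite (_ : k = j + (absz (k - j)%R)%:Z); last by lia.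
by case: (all (absz (k - j)%R)).
Qed.

End Reduction.

Section Modules.
Variables (R : realType) (M : NSmodule R).
Implicit Types (a b : NSbasis) (x y : NS R) (v : M).

Definition act x : M -> M := NSact x.
HB.instance Definition _ x :=
  GRing.isLinear.Build R[i] M M _ (act x) (NSact_linear_r x).

Lemma act0l v : act 0 v = 0.
Proof.
by have := NSact_linear_l v (-1) 0 0; rewrite scaler0 addr0 scaleN1r addNr.
Qed.

Lemma actDl x y v : act (x + y) v = act x v + act y v.
Proof. by have := NSact_linear_l v 1 x y; rewrite !scale1r. Qed.

Lemma actZl c x v : act (c *: x) v = c *: act x v.
Proof. by have := NSact_linear_l v c x 0; rewrite addr0 -/(act 0 v) act0l addr0. Qed.

Lemma actNl x v : act (- x) v = - act x v.
Proof. by rewrite -[- x]scaleN1r actZl scaleN1r. Qed.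

Lemma act_suml (I : Type) (s : seq I) (F : I -> NS R) v :
  act (\sum_(k <- s) F k) v = \sum_(k <- s) act (F k) v.
Proof.
elim/big_rec2: _ => [|k y1 y2 _ <-]; [exact: act0l | exact: actDl].
Qed.

Lemma NShomog_basis a : NShomog (NSbasis_odd a) (NSe R a).
Proof.
by move=> b; rewrite msuppU oner_eq0 inE => /eqP->.
Qed.

Lemma NSbracket_basis a b : NSbracket (NSe R a) (NSe R b) = NSbasis_bracket R a b.
Proof.
rewrite /NSbracket /NSe !msuppU oner_eq0 !big_seq_fset1 !mcoeffU !eqxx.
by rewrite mul1r scale1r.
Qed.

Lemma act_bracket a b v :
  act (NSe R a) (act (NSe R b) v)
  - (-1) ^+ (NSbasis_odd a && NSbasis_odd b) *: act (NSe R b) (act (NSe R a) v)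
  = act (NSbasis_bracket R a b) v.
Proof.
rewrite -NSbracket_basis [RHS](NSact_bracket (@NShomog_basis a) (@NShomog_basis b)).
by [].
Qed.

Lemma act_bracket_even a b v : NSbasis_odd a && NSbasis_odd b = false ->
  act (NSe R a) (act (NSe R b) v) - act (NSe R b) (act (NSe R a) v)
  = act (NSbasis_bracket R a b) v.
Proof. by move=> ab; have := act_bracket a b v; rewrite ab expr0 scale1r. Qed.

Lemma act_bracket_odd a b v : NSbasis_odd a && NSbasis_odd b ->
  act (NSe R a) (act (NSe R b) v) + act (NSe R b) (act (NSe R a) v)
  = act (NSbasis_bracket R a b) v.
Proof.
by move=> ab; have := act_bracket a b v; rewrite ab expr1 scaleN1r opprK.
Qed.

Lemma act_combB c d x y v u w :
  act x v = u -> act y v = w -> act (c *: x - d *: y) v = c *: u - d *: w.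
Proof.
move=> <- <-; apply: etrans (actDl _ _ v) _.
by congr (_ + _); [exact: actZl | apply: etrans (actNl _ v) _; rewrite actZl].
Qed.

Lemma act_combD c d x y v u w :
  act x v = u -> act y v = w -> act (c *: x + d *: y) v = c *: u + d *: w.
Proof.
by move=> <- <-; apply: etrans (actDl _ _ v) _; congr (_ + _); exact: actZl.
Qed.

Lemma submodule_basis (U : M -> Prop) : subspace U ->
  (forall a v, U v -> U (act (NSe R a) v)) -> submodule U.
Proof.
move=> US Ua; split=> // x v Uv; rewrite -/(act x v) (monalgE x) act_suml.
elim/big_ind: _ => [|u w|a _]; [by case: US | exact: subspaceD |].
have -> : << x@_a *g a >> = x@_a *: NSe R a.
  by apply/malgP => b; rewrite mcoeffZ !mcoeffU mulr_natr.
by rewrite actZl; apply: (subspaceZ _ US); apply: Ua.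
Qed.

(** These become [par] and [par_sign], covering ungraded and graded simplicity at once. *)
Variables (sigma : M -> M) (eta : R[i]).
Hypothesis sigma_linear : linear sigma.
Hypothesis sigmaK : forall v, sigma (sigma v) = v.
Hypothesis eta_sq : eta * eta = 1.
Hypothesis sigma_act : forall a v,
  sigma (act (NSe R a) v)
  = (if NSbasis_odd a then eta else 1) *: act (NSe R a) (sigma v).
Hypothesis M_neq0 : exists v : M, v <> 0.
Hypothesis M_simple : forall U : M -> Prop, submodule U ->
  (forall v, U v -> U (sigma v)) -> trivial_or_full U.
Hypothesis M_weight : weight_module M.

Definition parity : M -> M := sigma.
HB.instance Definition _ :=
  GRing.isLinear.Build R[i] M M _ parity sigma_linear.

(** A nonzero vector is a sum of common eigenvectors, so c has an eigenvector; its eigenspace is a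
    nonzero submodule stable under [sigma], hence everything. *)
Lemma central_charge : exists z : R[i], forall v, act (NSe R NSc) v = z *: v.
Proof.
have [v0 /eqP v00] := M_neq0; have [s [seig sE]] := M_weight v0.
have [w ws] : exists w, w \in s.
  case: s sE {seig} => [|w s] sE; last by exists w; rewrite mem_head.
  by move: v00; rewrite sE big_nil eqxx.
have [/eqP w0 weig] := seig _ ws.
have [|z wz] := weig (NSe R NSc).
  by exists 0, 1; rewrite scale0r add0r scale1r.
exists z; pose U v := act (NSe R NSc) v = z *: v.
have US : subspace U.
  split=> [|c u v Uu Uv]; first by rewrite /U linear0 scaler0.
  rewrite /U linearP /=; move: Uu Uv; rewrite /U => -> ->.
  by rewrite scalerDr !scalerA mulrC.
have Usub : submodule U.
  apply: submodule_basis => // a v Uv.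
  have /eqP := act_bracket NSc a v; rewrite [NSbasis_bracket _ _ _]/= act0l.
  by rewrite subr_eq0 scale1r Uv /U => /eqP->; rewrite linearZ.
have [|Uz|//] := M_simple Usub.
  move=> v Uv; have := sigma_act NSc v; rewrite scale1r /U => <-.
  by move: Uv; rewrite /U => ->; exact: (linearZ_LR parity).
by case/eqP: w0; apply: Uz.
Qed.

Lemma simple_mixed_absurd : mixed M -> False.
Proof.
case: central_charge => z cE.
pose L n : {linear M -> M} := act (NSe R (NSL n)).
pose G n : {linear M -> M} := act (NSe R (NSG n)).
have ifz (b : bool) (x : R[i]) :
    (if b then x * z else 0) = (if b then x else 0) * z.
  by case: b; rewrite ?mul0r.
have LL m n v : L m (L n v) - L n (L m v) =
    (n - m)%:~R *: L (m + n) v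
    - (if m + n == 0 then (m ^+ 3 - m)%:~R / 12%:R * z else 0) *: v.
  rewrite ifz -scalerA.
  apply: etrans (@act_bracket_even (NSL m) (NSL n) v erefl) _.
  exact: (act_combB _ _ (erefl _) (cE v)).
have LG m n v : L m (G n v) - G n (L m v) =
    (half_shift R n - m%:~R / 2%:R) *: G (m + n) v.
  apply: etrans (@act_bracket_even (NSL m) (NSG n) v erefl) _.
  exact: actZl.
have GG m n v : G m (G n v) + G n (G m v) =
    2%:R *: L (m + n + 1) v
    + (if m + n + 1 == 0 then (4%:R * half_shift R m ^+ 2 - 1) / 12%:R * z
       else 0) *: v.
  rewrite ifz -scalerA.
  apply: etrans (@act_bracket_odd (NSG m) (NSG n) v erefl) _.
  exact: (act_combD _ _ (erefl _) (cE v)).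
have parL n v : parity (L n v) = L n (parity v).
  by rewrite [LHS](sigma_act (NSL n) v) scale1r.
have parG n v : parity (G n v) = eta *: G n (parity v).
  exact: (sigma_act (NSG n) v).
have simple (U : M -> Prop) : subspace U ->
    (forall v, U v -> U (G 0 v)) -> (forall v, U v -> U (G 1 v)) ->
    (forall v, U v -> U (G (-1) v)) -> (forall v, U v -> U (G (-2) v)) ->
    (forall v, U v -> U (parity v)) -> trivial_or_full U.
  (* The four odd generators produce the rest: L_1 and L_(-1) as squares, all G_r by repeated
     brackets with these, and L_n from the anticommutator of G_(1/2) and G_(n-1/2). *)
  move=> US U0 U1 Um1 Um2 Upar; apply: M_simple => //.
  have two0 : (2%:R : R[i]) != 0 by rewrite pnatr_eq0.
  have UGL m n v : U v -> (forall v, U v -> U (G m v)) ->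
      (forall v, U v -> U (G n v)) -> U (L (m + n + 1) v).
    move=> Uv Um Un; apply: (subspaceZI US two0).
    have /eqP := GG m n v; rewrite -subr_eq => /eqP <-.
    apply: (subspaceB US); last exact: (subspaceZ _ US).
    by apply: (subspaceD US); [apply/Um/Un | apply/Un/Um].
  have UL1 v : U v -> U (L 1 v).
    by move=> Uv; have := UGL 0 0 v Uv U0 U0; rewrite !add0r.
  have ULm1 v : U v -> U (L (-1) v).
    by move=> Uv; have := UGL (-1) (-1) v Uv Um1 Um1; rewrite subrK.
  (* [L_1, G_(1/2)] = 0, so the recursion starts from G_(3/2), after which the coefficient r - 1/2
     is nonzero. *)
  have Upos n v : U v -> U (G n%:Z v).
    elim: n v => [|[|n] IH] v Uv; [exact: U0 | exact: U1 |].
    have n0 : half_shift R n.+1%:Z - 1%:~R / 2%:R != 0.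
      have -> : half_shift R n.+1%:Z - 1%:~R / 2%:R = n.+1%:R.
        by rewrite /half_shift; field.
      by rewrite pnatr_eq0.
    apply: (subspaceZI US n0); have := LG 1 n.+1%:Z v.
    rewrite (_ : 1 + n.+1%:Z = n.+2); last by lia.
    by move=> <-; apply: (subspaceB US); [apply/UL1/IH | apply/IH/UL1].
  have Uneg n v : U v -> U (G (- n.+1%:Z) v).
    elim: n v => [|[|n] IH] v Uv; [exact: Um1 | exact: Um2 |].
    have n0 : half_shift R (- n.+2%:Z) - (-1)%:~R / 2%:R != 0.
      have -> : half_shift R (- n.+2%:Z) - (-1)%:~R / 2%:R = - n.+1%:R.
        by rewrite /half_shift !rmorphN /= -natr1; field.
      by rewrite oppr_eq0 pnatr_eq0.
    apply: (subspaceZI US n0); have := LG (-1) (- n.+2%:Z) v.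
    rewrite (_ : -1 - n.+2%:Z = - n.+3%:Z); last by lia.
    by move=> <-; apply: (subspaceB US); [apply/ULm1/IH | apply/IH/ULm1].
  have UG n v : U v -> U (G n v).
    by case: n => n; [exact: Upos | rewrite NegzE; exact: Uneg].
  apply: submodule_basis => // -[n|n|] v Uv; last by rewrite cE; apply: subspaceZ.
    by have := UGL 0 (n - 1) v Uv (UG 0) (UG _); rewrite add0r subrK.
  exact: UG.
pose r := @NsOps R M L G z parity eta LL LG GG eta_sq sigmaK parL parG simple.
move=> [lam [k [inf fin]]]; apply: (@finite_infinite_absurd _ _ r lam k 0 fin).
have -> : wsp r lam 0 = weight_space (M := M) lam; last by [].
by apply/funext => v; rewrite /wsp mul0r addr0.
Qed.

End Modules.

Lemma ungraded_mixed_absurd (R : realType) (M : NSmodule R) :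
  weight_module M -> simple_module M -> mixed M -> False.
Proof.
move=> wM [M0 sM]; apply: (@simple_mixed_absurd R M id 1) => //.
- exact: mulr1.
- by move=> a v; rewrite if_same scale1r.
- by move=> U /sM.
Qed.

(** * Graded modules *)

Section Graded.
Variables (R : realType) (M : NSmodule R) (gr : NSgrading M).
Implicit Types v : M.

Lemma grading_unique (a b a' b' : M) :
  NSpart gr false a -> NSpart gr true b ->
  NSpart gr false a' -> NSpart gr true b' -> a + b = a' + b' -> a = a' /\ b = b'.
Proof.
move=> ea ob ea' ob' E.
have S p := NSpart_subspace gr p.
have D : a - a' = b' - b.
  by rewrite -[a](addrK b) E [a' + b']addrC addrAC addrK.
have d0 : a - a' = 0.
  apply: (NSpart_direct (n := gr)); first exact: (subspaceB (S false)).
  by rewrite D; apply: (subspaceB (S true)).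
by split; apply/eqP; [|rewrite eq_sym]; rewrite -subr_eq0 -?D d0.
Qed.

(** With [sigma] negating the odd part, a submodule stable under [sigma] contains the halves of v +
    [sigma v] and v - [sigma v], so it is graded. *)
Lemma graded_mixed_absurd :
  weight_module M -> graded_simple_module gr -> mixed M -> False.
Proof.
move=> wM [M0 sM]; have S p := NSpart_subspace gr p.
have /choice[c cE] : forall v, exists p : M * M,
    [/\ NSpart gr false p.1, NSpart gr true p.2 & v = p.1 + p.2].
  by move=> v; have [a [b [ea ob E]]] := NSpart_span gr v; exists (a, b).
pose sigma v := (c v).1 - (c v).2.
have sigmaE a b : NSpart gr false a -> NSpart gr true b -> sigma (a + b) = a - b.
  move=> ea ob; have [e o E] := cE (a + b).
  by rewrite /sigma; have [<- <-] := grading_unique ea ob e o E.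
apply: (@simple_mixed_absurd R M sigma (-1)) => //.
- move=> k u v; have [eu ou uE] := cE u; have [ev ov vE] := cE v.
  rewrite {1}uE {1}vE scalerDr addrACA sigmaE.
  + by rewrite scalerBr opprD addrACA.
  + by case: (S false) => _; apply.
  + by case: (S true) => _; apply.
- move=> v; have [e o E] := cE v; rewrite [RHS]E [sigma v]/sigma sigmaE ?opprK //.
  by rewrite -scaleN1r; apply: (subspaceZ _ (S true)).
- by rewrite mulrNN mulr1.
- move=> a v; have [e o {1}->] := cE v.
  have hom := @NShomog_basis R a; rewrite linearD.
  have := NSpart_act hom e; have := NSpart_act hom o.
  rewrite [sigma v]/sigma linearB.
  case: (NSbasis_odd a) => /= ha hb.
    by rewrite addrC sigmaE // scaleN1r opprB.
  by rewrite sigmaE // scale1r.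
- move=> U Usub Usig; apply: sM; split=> // v0 v1 e0 o1 U01.
  have US := Usub.1; have two0 : (2%:R : R[i]) != 0 by rewrite pnatr_eq0.
  have U01' : U (v0 - v1) by rewrite -sigmaE //; apply: Usig.
  split; apply: (subspaceZI US two0); rewrite scaler_nat mulr2n.
    have -> : v0 + v0 = (v0 + v1) + (v0 - v1) by rewrite addrACA subrr addr0.
    exact: subspaceD.
  have -> : v1 + v1 = (v0 + v1) - (v0 - v1).
    by rewrite opprB [v0 + v1]addrC addrACA subrr addr0.
  exact: subspaceB.
Qed.

End Graded.

(* The second clause concerns Z/2-graded modules, with simplicity tested on
   graded submodules only. *)
Theorem mainTheorem3 (R : realType) :
  (~ exists M : NSmodule R,
       [/\ weight_module M, simple_module M & mixed M]) /\
  (~ exists (M : NSmodule R) (gr : NSgrading M),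
       [/\ weight_module M, graded_simple_module gr & mixed M]).
Proof.
split=> [[M [wM sM mM]]|[M [gr [wM sM mM]]]].
  exact: ungraded_mixed_absurd wM sM mM.
exact: graded_mixed_absurd wM sM mM.
Qed.
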